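(* Let $A$ be a unital $C^*$-algebra equipped with a strongly continuous circle action $\alpha:\mathbb S^1\to\operatorname{Aut}(A)$ and a faithful, tracial, $\alpha$-invariant state $\omega:A\to\mathbb C$. Let $\pi_0:A_\infty\to A_\infty^0$, $\pi_0(a):=\frac1{2\pi}\int_0^{2\pi}\alpha_t(a)\,dt$, be the projection onto the zero-weight elements. Consider the Lie algebra $\mathfrak g:=A_\infty\oplus A_\infty$ with the componentwise commutator bracket $[(x_1,x_2),(y_1,y_2)]:=([x_1,y_1],[x_2,y_2])$ and the symmetric bilinear form $$\langle\langle(a,a'),(x,y)\rangle\rangle:=\omega(ax)-\omega(a'y).$$ Define $$\mathfrak p_1:=\{(a,a)\mid a\in A_\infty\},\qquad \mathfrak p_2:=\{(x,y)\mid x\in A_\infty^{\ge0},\ y\in A_\infty^{\le0},\ \pi_0(x)+\pi_0(y)=0\},$$ where $A_\infty^{\ge0}:=\bigoplus_{m\ge0}A_\infty^m$ and $A_\infty^{\le0}:=\bigoplus_{m\le0}A_\infty^m$. If the zero-weight subspace $A_\infty^0$ is abelian with respect to the commutator bracket (i.e. $[a,b]=0$ for all $a,b\in A_\infty^0$), then $(\mathfrak g,\mathfrak p_1,\mathfrak p_2)$ is a Manin triple.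
   Context: The circle is parametrized by $t\in\mathbb R/2\pi\mathbb Z$. A state $\omega$ is $\alpha$-invariant if $\omega(\alpha_t(a))=\omega(a)$ for all $t,a$, and tracial if $\omega(ab)=\omega(ba)$. The space of smooth vectors is $A_\infty:=\{a\in A: t\mapsto\alpha_t(a)\text{ is }C^\infty\}$, a Fréchet space with the seminorms $\|a\|_{(k)}:=\max_{0\le j\le k}\sup_{t\in[0,2\pi]}\|\frac{d^j}{dt^j}\alpha_t(a)\|_A$, $k\in\mathbb N_0$. Its weight spaces are $A_\infty^m:=\{a\in A_\infty:\alpha_t(a)=e^{imt}a\ \forall t\}$, $m\in\mathbb Z$, with Fourier projections $P_m(a)=\frac1{2\pi}\int_0^{2\pi}e^{-imt}\alpha_t(a)\,dt$. Direct sums of weight spaces are topological: $A_\infty=\bigoplus_{m}A^m_\infty$ means each $a$ is uniquely a convergent series $a=\sum_mP_m(a)$ in $A_\infty$; thus $A_\infty^{\ge0}=\{a\in A_\infty:P_m(a)=0\ \forall m<0\}$ and $A_\infty^{\le0}=\{a\in A_\infty:P_m(a)=0\ \forall m>0\}$. Manin triple: a triple $(\mathfrak g,\mathfrak g_+,\mathfrak g_-)$ of convenient (here Fréchet) Lie algebras, $\mathfrak g_\pm$ Lie subalgebras of $\mathfrak g$, with $\mathfrak g=\mathfrak g_+\oplus\mathfrak g_-$ (topologically) and a weakly nondegenerate symmetric ad-invariant bilinear form on $\mathfrak g$ for which $\mathfrak g_+$ and $\mathfrak g_-$ are isotropic, such that the map $\mathfrak g_+\times\mathfrak g_-\to\mathfrak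 g_-\subseteq\mathfrak g_+'$, $(\alpha,\beta)\mapsto\operatorname{ad}^*_\alpha(\beta)$ (the coadjoint action of $\mathfrak g_+$ under the identification of $\mathfrak g_-$ with functionals on $\mathfrak g_+$ by the form, i.e. the $\mathfrak g_-$-component of $[\alpha,\beta]$) is bounded with respect to the topology of $\mathfrak g_-$. Weakly nondegenerate: $\langle x,\cdot\rangle=0$ implies $x=0$. *)

(* Defs.v *)
From Stdlib Require Import ssreflect Reals Lra ZArith ProofIrrelevance.
From Coquelicot Require Import Coquelicot.

Open Scope R_scope.

(** The real Banach space underlying a complex one: [is_derive] and [RInt] for
    functions of a real variable need a normed module over [R_AbsRing]; carrier,
    norm and topology are unchanged. *)

Section Realify.
Context (V : CompleteNormedModule C_AbsRing).

Lemma realify_scal_assoc (x y : R) (u : V) :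
  scal (RtoC x) (scal (RtoC y) u) = scal (RtoC (mult x y)) u.
Proof.
rewrite scal_assoc; f_equal; symmetry; exact (RtoC_mult x y).
Qed.

Lemma realify_scal_distr_r (x y : R) (u : V) :
  scal (RtoC (plus x y)) u = plus (scal (RtoC x) u) (scal (RtoC y) u).
Proof.
rewrite -scal_distr_r; f_equal; exact (RtoC_plus x y).
Qed.

Definition realify_ModuleSpace_mixin : ModuleSpace.mixin_of R_Ring V :=
  ModuleSpace.Mixin R_Ring V (fun r v => scal (RtoC r) v)
    realify_scal_assoc
    (fun u => scal_one u)
    (fun x u v => scal_distr_l (RtoC x) u v)
    realify_scal_distr_r.

Definition realify_NormedModuleAux : NormedModuleAux R_AbsRing :=
  NormedModuleAux.Pack R_AbsRing V
    (NormedModuleAux.Class R_AbsRing V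
      (ModuleSpace.Class R_Ring V
        (AbelianGroup.class V) realify_ModuleSpace_mixin)
      (UniformSpace.class V)) V.

Lemma realify_norm_scal (r : R) (x : V) :
  norm (scal (RtoC r) x) <= Rabs r * norm x.
Proof.
rewrite -Cmod_R; exact (norm_scal (RtoC r : C_AbsRing) x).
Qed.

Definition realify_NormedModule_mixin :
    NormedModule.mixin_of R_AbsRing realify_NormedModuleAux :=
  NormedModule.Mixin R_AbsRing realify_NormedModuleAux
    (fun v : V => norm v) (@norm_factor _ V)
    (fun x y => norm_triangle (V := V) x y)
    realify_norm_scal
    (fun x y e => norm_compat1 (V := V) x y e)
    (fun x y e => norm_compat2 (V := V) x y e)
    (fun x => norm_eq_zero (V := V) x).

Definition realify : CompleteNormedModule R_AbsRing :=
  CompleteNormedModule.Pack R_AbsRing V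
    (CompleteNormedModule.Class R_AbsRing V
      (NormedModule.Class R_AbsRing V
        (NormedModuleAux.class R_AbsRing realify_NormedModuleAux)
        realify_NormedModule_mixin)
      (CompleteSpace.class V)) V.

End Realify.

(* Continuity of the derivatives of order less than n is automatic. *)
Fixpoint Cn {V : NormedModule R_AbsRing} (n : nat) (f : R -> V) : Prop :=
  match n with
  | O => forall t, continuous f t
  | S n' => exists f' : R -> V, (forall t, is_derive f t (f' t)) /\ Cn n' f'
  end.

Definition Cinfty {V : NormedModule R_AbsRing} (f : R -> V) : Prop :=
  forall n, Cn n f.

(* Meaningful only where f is differentiable, like [Derive] and [RInt]. *)
Definition vderive {V : CompleteNormedModule R_AbsRing} (f : R -> V) : R -> V :=
  fun t => iota (fun l => is_derive f t l).

Definition vderive_n {V : CompleteNormedModule R_AbsRing} (f : R -> V)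
    (j : nat) : R -> V :=
  Nat.iter j vderive f.

Definition cis (x : R) : C := (cos x, sin x).

Record CStarAlgebra := {
  cs_space :> CompleteNormedModule C_AbsRing;
  cs_mul : cs_space -> cs_space -> cs_space;
  cs_one : cs_space;
  cs_star : cs_space -> cs_space;
  cs_mul_assoc : forall a b c,
    cs_mul a (cs_mul b c) = cs_mul (cs_mul a b) c;
  cs_mul_one_l : forall a, cs_mul cs_one a = a;
  cs_mul_one_r : forall a, cs_mul a cs_one = a;
  cs_mul_plus_l : forall a b c,
    cs_mul (plus a b) c = plus (cs_mul a c) (cs_mul b c);
  cs_mul_plus_r : forall a b c,
    cs_mul a (plus b c) = plus (cs_mul a b) (cs_mul a c);
  cs_mul_scal_l : forall (k : C) a b,
    cs_mul (scal k a) b = scal k (cs_mul a b);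
  cs_mul_scal_r : forall (k : C) a b,
    cs_mul a (scal k b) = scal k (cs_mul a b);
  cs_norm_mul : forall a b, norm (cs_mul a b) <= norm a * norm b;
  cs_star_star : forall a, cs_star (cs_star a) = a;
  cs_star_plus : forall a b,
    cs_star (plus a b) = plus (cs_star a) (cs_star b);
  cs_star_scal : forall (k : C) a,
    cs_star (scal k a) = scal (Cconj k) (cs_star a);
  cs_star_mul : forall a b, cs_star (cs_mul a b) = cs_mul (cs_star b) (cs_star a);
  cs_norm_star_mul : forall a, norm (cs_mul (cs_star a) a) = norm a * norm a
}.

Arguments cs_mul {_} _ _.
Arguments cs_one {_}.
Arguments cs_star {_} _.

Record star_automorphism {A : CStarAlgebra} (f : A -> A) : Prop := {
  aut_plus : forall a b, f (plus a b) = plus (f a) (f b);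
  aut_scal : forall (k : C) a, f (scal k a) = scal k (f a);
  aut_mul : forall a b, f (cs_mul a b) = cs_mul (f a) (f b);
  aut_star : forall a, f (cs_star a) = cs_star (f a);
  aut_bij : forall b, exists! a, f a = b
}.

(* Strongly continuous action of R / 2 pi Z, as a 2 pi-periodic action of R. *)
Record CircleAction (A : CStarAlgebra) := {
  act :> R -> A -> A;
  act_aut : forall t, star_automorphism (act t);
  act_zero : forall a, act 0 a = a;
  act_add : forall s t a, act (s + t) a = act s (act t a);
  act_period : forall a, act (2 * PI) a = a;
  act_continuous : forall a t, continuous (fun s : R => act s a) t
}.

Section States.
Context {A : CStarAlgebra}.

(* For a positive linear functional, norm one amounts to [om cs_one = 1]. *)
Record is_state (om : A -> C) : Prop := {
  state_plus : forall a b, om (plus a b) = (om a + om b)%C;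
  state_scal : forall (k : C) a, om (scal k a) = (k * om a)%C;
  state_pos : forall a,
    Im (om (cs_mul (cs_star a) a)) = 0 /\ 0 <= Re (om (cs_mul (cs_star a) a));
  state_norm :
    is_lub (fun r => exists a : A, norm a <= 1 /\ r = Cmod (om a)) 1
}.

Definition faithful (om : A -> C) : Prop :=
  forall a, om (cs_mul (cs_star a) a) = RtoC 0 -> a = zero.

Definition tracial (om : A -> C) : Prop :=
  forall a b, om (cs_mul a b) = om (cs_mul b a).

Definition invariant (al : CircleAction A) (om : A -> C) : Prop :=
  forall t a, om (al t a) = om a.

End States.

(** Locally convex topologies are given by a sequence [p] of seminorms, not
    assumed increasing. *)

Section Frechet.
Context {V : ModuleSpace C_AbsRing}.
Variable p : nat -> V -> R.

Definition seminorm (q : V -> R) : Prop :=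
  (forall x, 0 <= q x) /\
  (forall x y, q (plus x y) <= q x + q y) /\
  (forall (k : C) x, q (scal k x) = Cmod k * q x).

Definition sn_nbhs (x : V) : (V -> Prop) -> Prop :=
  fun P => exists (k : nat) (d : posreal),
    forall y, (forall j, (j <= k)%nat -> p j (minus y x) < d) -> P y.

Definition sn_cauchy (u : nat -> V) : Prop :=
  forall (k : nat) (e : posreal), exists N : nat, forall n m,
    (N <= n)%nat -> (N <= m)%nat -> p k (minus (u n) (u m)) < e.

Definition subspace (E : V -> Prop) : Prop :=
  E zero /\ (forall x y, E x -> E y -> E (plus x y)) /\
  (forall (k : C) x, E x -> E (scal k x)).

(* [E] is a Fréchet space for the topology induced by [p]. *)
Definition frechet_space (E : V -> Prop) : Prop :=
  subspace E /\
  (forall x, E x -> (forall k, p k x = 0) -> x = zero) /\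
  (forall u, (forall n, E (u n)) -> sn_cauchy u ->
     exists l, E l /\ filterlim u eventually (sn_nbhs l)).

Definition bounded_set (B : V -> Prop) : Prop :=
  forall k, exists M, forall x, B x -> p k x <= M.

Definition bounded_functional_on (E : V -> Prop) (f : V -> C) : Prop :=
  forall B, (forall x, B x -> E x) -> bounded_set B ->
    exists M, forall x, B x -> Cmod (f x) <= M.

Definition bounded_bilinear_on (E F : V -> Prop) (b : V -> V -> V) : Prop :=
  forall B1 B2,
    (forall x, B1 x -> E x) -> (forall y, B2 y -> F y) ->
    bounded_set B1 -> bounded_set B2 ->
    bounded_set (fun z => exists x y, B1 x /\ B2 y /\ z = b x y).

Record bilinear {W : ModuleSpace C_AbsRing} (b : V -> V -> W) : Prop := {
  bil_plus_l : forall x y z, b (plus x y) z = plus (b x z) (b y z);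
  bil_plus_r : forall x y z, b x (plus y z) = plus (b x y) (b x z);
  bil_scal_l : forall (k : C) x y, b (scal k x) y = scal k (b x y);
  bil_scal_r : forall (k : C) x y, b x (scal k y) = scal k (b x y)
}.

Record frechet_lie_algebra (br : V -> V -> V) : Prop := {
  fla_seminorm : forall k, seminorm (p k);
  fla_frechet : frechet_space (fun _ => True);
  fla_bilinear : bilinear br;
  fla_alternating : forall x, br x x = zero;
  fla_jacobi : forall x y z,
    plus (br x (br y z)) (plus (br y (br z x)) (br z (br x y))) = zero;
  fla_continuous : forall x y,
    filterlim (fun z => br (fst z) (snd z))
      (filter_prod (sn_nbhs x) (sn_nbhs y)) (sn_nbhs (br x y))
}.

Definition frechet_lie_subalgebra (br : V -> V -> V) (E : V -> Prop) : Prop :=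
  frechet_space E /\ (forall x y, E x -> E y -> E (br x y)).

Record topological_direct_sum (E F : V -> Prop) (prE prF : V -> V) : Prop := {
  tds_in_l : forall x, E (prE x);
  tds_in_r : forall x, F (prF x);
  tds_sum : forall x, x = plus (prE x) (prF x);
  tds_inter : forall x, E x -> F x -> x = zero;
  tds_continuous_l : forall x, filterlim prE (sn_nbhs x) (sn_nbhs (prE x));
  tds_continuous_r : forall x, filterlim prF (sn_nbhs x) (sn_nbhs (prF x))
}.

(* ad*_x applied to the functional <y, .>, evaluated at z. *)
Definition coadjoint (br : V -> V -> V) (form : V -> V -> C) (x y z : V) : C :=
  (- form y (br x z))%C.

(* The last three fields concern the inclusion y |-> <y, .> of g_- into the
   bounded dual of g_+.  [mt_coadjoint] says that this inclusion takes the
   g_- -component of [x, y] to ad*_x y. *)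
Record manin_triple_with (br : V -> V -> V) (form : V -> V -> C)
    (gp gm : V -> Prop) (prp prm : V -> V) : Prop := {
  mt_lie : frechet_lie_algebra br;
  mt_plus : frechet_lie_subalgebra br gp;
  mt_minus : frechet_lie_subalgebra br gm;
  mt_sum : topological_direct_sum gp gm prp prm;
  mt_bilinear : bilinear (W := C_NormedModule) form;
  mt_symmetric : forall x y, form x y = form y x;
  mt_invariant : forall x y z, form (br x y) z = form x (br y z);
  mt_nondegenerate : forall x, (forall y, form x y = RtoC 0) -> x = zero;
  mt_isotropic_plus : forall x y, gp x -> gp y -> form x y = RtoC 0;
  mt_isotropic_minus : forall x y, gm x -> gm y -> form x y = RtoC 0;
  mt_dual : forall y, gm y -> bounded_functional_on gp (form y);
  mt_coadjoint : forall x y z, gp x -> gm y -> gp z ->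
    form (prm (br x y)) z = coadjoint br form x y z;
  mt_coadjoint_bounded : bounded_bilinear_on gp gm (fun x y => prm (br x y))
}.

Definition manin_triple (br : V -> V -> V) (form : V -> V -> C)
    (gp gm : V -> Prop) : Prop :=
  exists prp prm, manin_triple_with br form gp gm prp prm.

End Frechet.

Lemma plus_minus_cancel {G : AbelianGroup} (x y : G) : plus x (minus y x) = y.
Proof.
unfold minus; rewrite (plus_comm y) plus_assoc (plus_opp_r x) plus_zero_l.
reflexivity.
Qed.

Lemma minus_plus_4 {G : AbelianGroup} (p q r s : G) :
  minus (minus (plus (plus p q) (plus r s)) p) (plus r q) = s.
Proof.
assert (C1 : forall z w : G, minus (plus z w) w = z).
{ intros z w; unfold minus.
  rewrite -plus_assoc (plus_opp_r w) plus_zero_r; reflexivity. }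
rewrite (plus_comm (plus p q)) (plus_comm r s) (plus_comm p q).
rewrite plus_assoc C1 -plus_assoc C1; reflexivity.
Qed.

Section BilinearDerive.
Context {V : NormedModule R_AbsRing}.
Variable b : V -> V -> V.
Hypothesis b_plus_l : forall x y z, b (plus x y) z = plus (b x z) (b y z).
Hypothesis b_plus_r : forall x y z, b x (plus y z) = plus (b x y) (b x z).
Hypothesis b_scal_l : forall (k : R) x y, b (scal k x) y = scal k (b x y).
Hypothesis b_scal_r : forall (k : R) x y, b x (scal k y) = scal k (b x y).
Hypothesis b_norm : forall x y, norm (b x y) <= norm x * norm y.

Lemma b_remainder x y u v :
  minus (minus (b u v) (b x y)) (plus (b (minus u x) y) (b x (minus v y)))
  = b (minus u x) (minus v y).
Proof.
assert (E : forall d e : V,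
  minus (minus (b (plus x d) (plus y e)) (b x y)) (plus (b d y) (b x e)) = b d e).
{ intros d e; rewrite b_plus_l !b_plus_r; 
  exact (minus_plus_4 (G := V) (b x y) (b x e) (b d y) (b d e)). }
generalize (E (minus u x) (minus v y)).
rewrite (plus_minus_cancel (G := V) x u) (plus_minus_cancel (G := V) y v); auto.
Qed.

Lemma filterdiff_bilinear (x y : V) :
  filterdiff (fun t : prod_NormedModule R_AbsRing V V => b (fst t) (snd t))
    (locally (x, y))
    (fun t : prod_NormedModule R_AbsRing V V => plus (b (fst t) y) (b x (snd t))).
Proof.
split.
- split.
  + intros [u v] [u' v']; simpl; rewrite b_plus_l b_plus_r.
    rewrite -!plus_assoc; f_equal; rewrite !plus_assoc; f_equal; apply plus_comm.
  + intros k [u v]; simpl; rewrite b_scal_l b_scal_r scal_distr_l; reflexivity.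
  + exists (norm y + norm x + 1); split.
    { generalize (norm_ge_0 x) (norm_ge_0 y); lra. }
    intros [u v]; simpl.
    generalize (norm_triangle (b u y) (b x v)) (b_norm u y) (b_norm x v); intros.
    generalize (norm_le_prod_norm_1 (u, v)) (norm_le_prod_norm_2 (u, v)); simpl; intros.
    generalize (norm_ge_0 x) (norm_ge_0 y) (norm_ge_0 u) (norm_ge_0 v); intros.
    set (N := norm ((u, v) : prod_NormedModule R_AbsRing V V)) in *.
    assert (norm u <= N) by assumption.
    assert (norm v <= N) by assumption.
    assert (norm u * norm y <= N * norm y) by (apply Rmult_le_compat_r; assumption).
    assert (norm x * norm v <= norm x * N) by (apply Rmult_le_compat_l; assumption).
    apply Rle_trans with (norm (b u y) + norm (b x v)); [assumption|].
    apply Rle_trans with (N * norm y + norm x * N); [lra|]. nra.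
- intros z Hz eps.
  assert (E := is_filter_lim_locally_unique
    (V := prod_NormedModule R_AbsRing V V) (x, y) z Hz); subst z; clear Hz.
  apply (locally_le_locally_norm (V := prod_NormedModule R_AbsRing V V) (x, y)).
  exists eps; intros [u v] Huv; simpl.
  rewrite b_remainder.
  generalize (norm_le_prod_norm_1 (minus (u, v) ((x, y) : prod_NormedModule R_AbsRing V V)))
    (norm_le_prod_norm_2 (minus (u, v) ((x, y) : prod_NormedModule R_AbsRing V V))).
  unfold ball_norm in Huv.
  set (N := norm (minus (u, v) ((x, y) : prod_NormedModule R_AbsRing V V))) in *.
  intros H1 H2.
  change (norm (minus u x) <= N) in H1.
  change (norm (minus v y) <= N) in H2.
  change (norm (b (minus u x) (minus v y)) <= eps * N).
  change (N < eps) in Huv.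
  generalize (b_norm (minus u x) (minus v y)) (norm_ge_0 (minus u x))
    (norm_ge_0 (minus v y)); intros.
  apply Rle_trans with (norm (minus u x) * norm (minus v y)); [assumption|].
  apply Rmult_le_compat; lra.
Qed.

Lemma is_derive_bilinear (f g : R -> V) (t : R) (f' g' : V) :
  is_derive f t f' -> is_derive g t g' ->
  is_derive (fun s => b (f s) (g s)) t (plus (b f' (g t)) (b (f t) g')).
Proof.
intros Hf Hg.
unfold is_derive.
eapply filterdiff_ext_lin.
- exact (filterdiff_comp'_2 f g b t _ _ (fun u v => plus (b u (g t)) (b (f t) v))
    Hf Hg (filterdiff_bilinear (f t) (g t))).
- intros s; simpl; rewrite b_scal_l b_scal_r scal_distr_l; reflexivity.
Qed.

Lemma continuous_bilinear (f g : R -> V) (t : R) :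
  continuous f t -> continuous g t -> continuous (fun s => b (f s) (g s)) t.
Proof.
intros Hf Hg.
apply (continuous_comp_2 f g b t Hf Hg).
apply (filterdiff_continuous
  (fun z : prod_NormedModule R_AbsRing V V => b (fst z) (snd z)) (f t, g t)).
eexists; apply filterdiff_bilinear.
Qed.

Lemma Cn_continuous n (f : R -> V) : Cn n f -> forall t, continuous f t.
Proof.
destruct n as [|n]; simpl; auto.
intros [f' [Hf _]] t; apply ex_derive_continuous; eexists; apply Hf.
Qed.

Lemma Cn_pred n (f : R -> V) : Cn (S n) f -> Cn n f.
Proof.
revert f; induction n as [|n IH]; intros f H.
- exact (Cn_continuous 1 f H).
- destruct H as [f' [Hf H]]; exists f'; split; auto.
Qed.

Lemma Cn_const n (a : V) : Cn n (fun _ => a).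
Proof.
revert a; induction n as [|n IH]; intros a; simpl.
- intros t; apply continuous_const.
- exists (fun _ => zero); split; auto; intros t.
  exact (is_derive_const (K := R_AbsRing) a t).
Qed.

Lemma Cn_plus n (f g : R -> V) : Cn n f -> Cn n g -> Cn n (fun t => plus (f t) (g t)).
Proof.
revert f g; induction n as [|n IH]; intros f g; simpl.
- intros Hf Hg t; apply (continuous_plus f g t); auto.
- intros [f' [Hf Hf']] [g' [Hg Hg']].
  exists (fun t => plus (f' t) (g' t)); split; auto.
  intros t; apply (is_derive_plus f g t); auto.
Qed.

Lemma Cn_bilinear n (f g : R -> V) : Cn n f -> Cn n g -> Cn n (fun t => b (f t) (g t)).
Proof.
revert f g; induction n as [|n IH]; intros f g Hf Hg.
- intros t; apply continuous_bilinear; [apply Hf | apply Hg].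
- assert (Pf := Cn_pred n f Hf); assert (Pg := Cn_pred n g Hg).
  destruct Hf as [f' [Hf Hf']], Hg as [g' [Hg Hg']].
  exists (fun t => plus (b (f' t) (g t)) (b (f t) (g' t))); split.
  + intros t; apply is_derive_bilinear; auto.
  + apply Cn_plus; apply IH; auto.
Qed.

Lemma Cn_ext n (f g : R -> V) : (forall t, f t = g t) -> Cn n f -> Cn n g.
Proof.
revert f g; induction n as [|n IH]; intros f g E; simpl.
- intros Hf t; apply (continuous_ext f g t E); auto.
- intros [f' [Hf Hf']]; exists f'; split; auto.
  intros t; apply (is_derive_ext f g t); auto.
Qed.

End BilinearDerive.

Section SmoothVectors.
Context {A : CStarAlgebra} (al : CircleAction A).

Definition is_smooth (a : A) : Prop :=
  Cinfty (V := realify A) (fun t => al t a).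

Lemma act_zero_vec t : al t zero = zero.
Proof.
rewrite -(scal_zero_l (zero : A)) (aut_scal _ (act_aut A al t)).
rewrite !(scal_zero_l (V := A)); reflexivity.
Qed.

Lemma smooth_zero : is_smooth zero.
Proof.
intros n.
apply (Cn_ext (V := realify A) n (fun _ => zero : A)); [|apply Cn_const].
intros t; symmetry; apply act_zero_vec.
Qed.

Lemma smooth_plus a b : is_smooth a -> is_smooth b -> is_smooth (plus a b).
Proof.
intros Ha Hb n.
apply (Cn_ext (V := realify A) n (fun t => plus (al t a) (al t b))).
- intros t; symmetry; apply (aut_plus _ (act_aut A al t)).
- apply (Cn_plus (V := realify A)); auto.
Qed.

Lemma smooth_mul a b : is_smooth a -> is_smooth b -> is_smooth (cs_mul a b).
Proof.
intros Ha Hb n.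
apply (Cn_ext (V := realify A) n (fun t => cs_mul (al t a) (al t b))).
- intros t; symmetry; apply (aut_mul _ (act_aut A al t)).
- apply (Cn_bilinear (V := realify A) cs_mul); auto.
  + exact (cs_mul_plus_l A).
  + exact (cs_mul_plus_r A).
  + intros k x y; exact (cs_mul_scal_l A (RtoC k) x y).
  + intros k x y; exact (cs_mul_scal_r A (RtoC k) x y).
  + exact (cs_norm_mul A).
Qed.

Lemma smooth_scal (k : C) a : is_smooth a -> is_smooth (scal k a).
Proof.
intros Ha.
assert (Hk : is_smooth (scal k cs_one)).
{ assert (H1 : forall t, al t cs_one = cs_one).
  { intros t; destruct (aut_bij _ (act_aut A al t) cs_one) as [e [He _]].
    transitivity (cs_mul (al t cs_one) (al t e)).
    - rewrite He; symmetry; apply cs_mul_one_r.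
    - rewrite -(aut_mul _ (act_aut A al t)) cs_mul_one_l; exact He. }
  intros n; apply (Cn_ext (V := realify A) n (fun _ => scal k cs_one : A));
    [|apply Cn_const].
  intros t; rewrite (aut_scal _ (act_aut A al t)) H1; reflexivity. }
rewrite -(cs_mul_one_l A a) -cs_mul_scal_l.
apply smooth_mul; assumption.
Qed.

Lemma smooth_opp a : is_smooth a -> is_smooth (opp a).
Proof.
intros Ha; rewrite -(scal_opp_one (V := A)); apply smooth_scal; exact Ha.
Qed.

Lemma smooth_minus a b : is_smooth a -> is_smooth b -> is_smooth (minus a b).
Proof. intros; apply smooth_plus; auto using smooth_opp. Qed.

Definition Ainf := {a : A | is_smooth a}.
Definition sval (a : Ainf) : A := proj1_sig a.

Lemma Ainf_ext (a b : Ainf) : sval a = sval b -> a = b.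
Proof.
destruct a as [a Ha], b as [b Hb]; simpl; intros E.
apply subset_eq_compat; exact E.
Qed.

Definition Ainf_plus (a b : Ainf) : Ainf :=
  exist _ (plus (sval a) (sval b)) (smooth_plus _ _ (proj2_sig a) (proj2_sig b)).
Definition Ainf_zero : Ainf := exist _ zero smooth_zero.
Definition Ainf_opp (a : Ainf) : Ainf :=
  exist _ (opp (sval a)) (smooth_opp _ (proj2_sig a)).
Definition Ainf_scal (k : C) (a : Ainf) : Ainf :=
  exist _ (scal k (sval a)) (smooth_scal k _ (proj2_sig a)).

Lemma Ainf_plus_comm a b : Ainf_plus a b = Ainf_plus b a.
Proof. apply Ainf_ext, plus_comm. Qed.
Lemma Ainf_plus_assoc a b c :
  Ainf_plus a (Ainf_plus b c) = Ainf_plus (Ainf_plus a b) c.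
Proof. apply Ainf_ext, plus_assoc. Qed.
Lemma Ainf_plus_zero a : Ainf_plus a Ainf_zero = a.
Proof. apply Ainf_ext, plus_zero_r. Qed.
Lemma Ainf_plus_opp a : Ainf_plus a (Ainf_opp a) = Ainf_zero.
Proof. apply Ainf_ext; exact (plus_opp_r (sval a)). Qed.
Lemma Ainf_scal_assoc (x y : C) a :
  Ainf_scal x (Ainf_scal y a) = Ainf_scal (Cmult x y) a.
Proof. apply Ainf_ext; exact (scal_assoc (x : C_AbsRing) y (sval a)). Qed.
Lemma Ainf_scal_one a : Ainf_scal (RtoC 1) a = a.
Proof. apply Ainf_ext; exact (scal_one (sval a)). Qed.
Lemma Ainf_scal_distr_l (x : C) a b :
  Ainf_scal x (Ainf_plus a b) = Ainf_plus (Ainf_scal x a) (Ainf_scal x b).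
Proof. apply Ainf_ext; exact (scal_distr_l (x : C_AbsRing) (sval a) (sval b)). Qed.
Lemma Ainf_scal_distr_r (x y : C) a :
  Ainf_scal (Cplus x y) a = Ainf_plus (Ainf_scal x a) (Ainf_scal y a).
Proof. apply Ainf_ext; exact (scal_distr_r (x : C_AbsRing) y (sval a)). Qed.

Definition Ainf_AbelianMonoid_mixin : AbelianMonoid.mixin_of Ainf :=
  AbelianMonoid.Mixin Ainf Ainf_plus Ainf_zero
    Ainf_plus_comm Ainf_plus_assoc Ainf_plus_zero.
Canonical Ainf_AbelianMonoid : AbelianMonoid :=
  AbelianMonoid.Pack Ainf Ainf_AbelianMonoid_mixin Ainf.
Definition Ainf_AbelianGroup_mixin : AbelianGroup.mixin_of Ainf_AbelianMonoid :=
  AbelianGroup.Mixin Ainf_AbelianMonoid Ainf_opp Ainf_plus_opp.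
Canonical Ainf_AbelianGroup : AbelianGroup :=
  AbelianGroup.Pack Ainf
    (AbelianGroup.Class Ainf Ainf_AbelianMonoid_mixin Ainf_AbelianGroup_mixin) Ainf.
Definition Ainf_ModuleSpace_mixin : ModuleSpace.mixin_of C_AbsRing Ainf_AbelianGroup :=
  ModuleSpace.Mixin C_AbsRing Ainf_AbelianGroup Ainf_scal
    Ainf_scal_assoc Ainf_scal_one Ainf_scal_distr_l Ainf_scal_distr_r.
Canonical Ainf_ModuleSpace : ModuleSpace C_AbsRing :=
  ModuleSpace.Pack C_AbsRing Ainf
    (ModuleSpace.Class C_AbsRing Ainf
      (AbelianGroup.class Ainf_AbelianGroup) Ainf_ModuleSpace_mixin) Ainf.

Definition Ainf_bracket (a b : Ainf) : Ainf :=
  exist _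
    (minus (cs_mul (sval a) (sval b)) (cs_mul (sval b) (sval a)))
    (smooth_minus _ _
      (smooth_mul _ _ (proj2_sig a) (proj2_sig b))
      (smooth_mul _ _ (proj2_sig b) (proj2_sig a))).

(* The supremum is finite, the derivatives of smooth orbits being continuous. *)
Definition orbit_sup (j : nat) (a : Ainf) : R :=
  real (Lub_Rbar (fun r => exists t, 0 <= t <= 2 * PI /\
    r = norm (vderive_n (V := realify A) (fun s => al s (sval a)) j t))).

Fixpoint Ainf_seminorm (k : nat) (a : Ainf) : R :=
  match k with
  | O => orbit_sup 0 a
  | S k' => Rmax (Ainf_seminorm k' a) (orbit_sup (S k') a)
  end.

Definition weight_space (m : Z) (a : Ainf) : Prop :=
  forall t, al t (sval a) = scal (cis (IZR m * t)) (sval a).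

Definition fourier_proj (m : Z) (a : Ainf) : A :=
  scal (RtoC (/ (2 * PI)))
    (RInt (V := realify A)
      (fun t => scal (cis (- (IZR m * t))) (al t (sval a))) 0 (2 * PI)).

Definition pi0 (a : Ainf) : A :=
  scal (RtoC (/ (2 * PI)))
    (RInt (V := realify A) (fun t => al t (sval a)) 0 (2 * PI)).

Definition Ainf_ge0 (a : Ainf) : Prop :=
  forall m, (m < 0)%Z -> fourier_proj m a = zero.

Definition Ainf_le0 (a : Ainf) : Prop :=
  forall m, (0 < m)%Z -> fourier_proj m a = zero.

Definition lie_double : ModuleSpace C_AbsRing :=
  prod_ModuleSpace C_AbsRing Ainf_ModuleSpace Ainf_ModuleSpace.

Definition lie_double_seminorm (k : nat) (z : lie_double) : R :=
  Rmax (Ainf_seminorm k (fst z)) (Ainf_seminorm k (snd z)).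

Definition lie_double_bracket (z w : lie_double) : lie_double :=
  (Ainf_bracket (fst z) (fst w), Ainf_bracket (snd z) (snd w)).

Definition lie_double_form (om : A -> C) (z w : lie_double) : C :=
  (om (cs_mul (sval (fst z)) (sval (fst w)))
   - om (cs_mul (sval (snd z)) (sval (snd w))))%C.

Definition p1 (z : lie_double) : Prop := exists a : Ainf, z = (a, a).

Definition p2 (z : lie_double) : Prop :=
  Ainf_ge0 (fst z) /\ Ainf_le0 (snd z) /\
  plus (pi0 (fst z)) (pi0 (snd z)) = zero.

End SmoothVectors.

(* Main.v *)
(** An automorphism of a C*-algebra is isometric: a self-adjoint [c] of norm less
    than one is [(u + u^* ) / 2] for the unitary [u = c + i sqrt (1 - c^2)], and
    unitaries are mapped to unitaries.  Hence the Fréchet seminorms of a smooth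
    vector [a] are the norms of its derivatives [D^j a].

    For [w] in [A_inf], the sum of [P_m w] over [m >= 1] equals [T (D^2 w)] with
    [T x] the absolutely convergent sum of [- m^-2 P_m x], a bounded operator
    commuting with the action.  So [H w = T (D^2 w) + P_0 w / 2] is a continuous
    operator on [A_inf], and [(u, v) = (u - H w, u - H w) + (H w, H w - w)] with
    [w = u - v] is the decomposition along [p1] and [p2].

    Elements are determined by their Fourier coefficients, so a smooth [x] of
    non-negative weights is [P_0 x + T (D^2 x)], a norm limit of sums of weight
    vectors.  It follows that [P_m (x y) = P_0 x * P_m y] for [m <= 0] whenever
    [x] and [y] have non-negative weights.  This gives both that [p2] is closed
    under the bracket, the weight-zero part being abelian, and, as the state
    factors through [P_0], that [p2] is isotropic. *)

Require Import Defs.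
From Stdlib Require Import ssreflect Reals Lra Lia ZArith Ncring Ncring_tac.
From Stdlib Require Import FunctionalExtensionality.
From Coquelicot Require Import Coquelicot.
Open Scope R_scope.

(** * Automorphisms of C*-algebras are isometric *)

(** On [A] itself the Hardy projection is in general unbounded for the norm, so the splitting lives
    on smooth vectors and costs derivatives. Two orders suffice because [m^-2] is summable; the
    projections are thus estimated by bounding order [k] by order [k + 2], which continuity and
    boundedness in a Fréchet space allow. Operators commuting with the action lose nothing: a norm
    bound on [A] holds with the same constant for every seminorm. In products only one factor is
    expanded, so no double series appears. Injectivity of the Fourier transform uses vector-valued
    integrals against powers of [(1 - cos t) / 2], a non-negative trigonometric kernel peaked at
    [PI]; no duality with functionals enters. The square root behind the isometry comes from a
    fixed-point iteration, whose terms are visibly self-adjoint and commute with [c]. The minus sign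
    of the form fits the opposite weight-zero parts in [p2]: both components contribute the state of
    the same product, and the two cancel. *)

Lemma norm_scal_eq {V : NormedModule C_AbsRing} (k : C) (x : V) :
  norm (scal k x) = Cmod k * norm x.
Proof.
apply Rle_antisym; [exact (norm_scal (k : C_AbsRing) x)|].
destruct (Ceq_dec k 0) as [->|Hk].
- rewrite Cmod_0 Rmult_0_l; apply norm_ge_0.
- assert (Hp := proj1 (Cmod_gt_0 k) Hk).
  assert (E : x = scal (/ k)%C (scal k x)).
  { rewrite scal_assoc.
    change (x = scal (/ k * k)%C x).
    rewrite (Cinv_l _ Hk); symmetry; exact (scal_one x). }
  assert (H := norm_scal ((/ k)%C : C_AbsRing) (scal k x)).
  rewrite -E in H; change (norm x <= Cmod (/ k) * norm (scal k x)) in H.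
  rewrite (Cmod_inv k Hk) in H.
  apply (Rmult_le_compat_l (Cmod k)) in H; [|lra].
  rewrite -Rmult_assoc Rinv_r in H; lra.
Qed.

(** * Limits of sequences in normed modules *)

Section SequenceLimits.
Context {K : AbsRing}.

Lemma filterlim_norm_iff {V : NormedModule K} (u : nat -> V) (l : V) :
  filterlim u eventually (locally l) <->
  forall e, 0 < e -> exists N, forall n, (N <= n)%nat -> norm (minus (u n) l) < e.
Proof.
rewrite (filterlim_locally_ball_norm (F := eventually)); split.
- intros H e He; exact (H (mkposreal e He)).
- intros H e; destruct (H e (cond_pos e)) as [N HN]; exists N; exact HN.
Qed.

Lemma norm_cauchy_complete {V : CompleteNormedModule K} (u : nat -> V) :
  (forall e, 0 < e -> exists N, forall n m, (N <= n)%nat -> (N <= m)%nat ->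
     norm (minus (u n) (u m)) < e) ->
  exists l, filterlim u eventually (locally l).
Proof.
intros H; apply (proj1 (filterlim_locally_closely (F := eventually) u)).
eapply filter_le_trans; [|apply (closely_norm_le_closely (V := V))].
apply (proj2 (filterlim_closely_norm (F := eventually) u)); intros e.
destruct (H e (cond_pos e)) as [N HN].
exists (fun n => (N <= n)%nat); split.
- exists N; auto.
- intros n m Hn Hm; exact (HN m n Hm Hn).
Qed.

Lemma norm_minus_triangle {V : NormedModule K} (x y z : V) :
  norm (minus x z) <= norm (minus x y) + norm (minus y z).
Proof. rewrite (minus_trans y x z); apply (@norm_triangle K V). Qed.

Lemma norm_lim_le {V : NormedModule K} (u : nat -> V) (l : V) (M : R) :
  filterlim u eventually (locally l) -> (forall n, norm (u n) <= M) -> norm l <= M.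
Proof.
intros H HM; apply Rnot_lt_le; intros Hlt.
destruct (proj1 (filterlim_norm_iff u l) H (norm l - M)) as [N HN]; [lra|].
specialize (HN N (le_n _)); specialize (HM N).
assert (E : l = minus (u N) (minus (u N) l)).
{ unfold minus; rewrite opp_plus opp_opp plus_assoc (plus_opp_r (u N)) plus_zero_l.
  reflexivity. }
assert (H1 := norm_triangle (u N) (opp (minus (u N) l))).
rewrite norm_opp in H1.
change (plus (u N) (opp (minus (u N) l))) with (minus (u N) (minus (u N) l)) in H1.
rewrite -E in H1; lra.
Qed.

End SequenceLimits.

(** The steps telescope to [norm (u (n + k) - u n) <= d n - d (n + k)]; hence [d] decreases to its
    limit 0, is non-negative, and [d n] bounds the whole tail. Applied with a geometric majorant for
    the square root and with a multiple of [1 / (n + 1)] for the smoothing operator. *)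
Lemma telescoping_converges {K : AbsRing} {V : CompleteNormedModule K} (u : nat -> V) (d : nat -> R) :
  (forall n, norm (minus (u (S n)) (u n)) <= d n - d (S n)) ->
  is_lim_seq d 0 ->
  exists l, filterlim u eventually (locally l).
Proof.
intros Hu Hd.
assert (Hk : forall n k, norm (minus (u (n + k)%nat) (u n)) <= d n - d (n + k)%nat).
{ intros n k; induction k as [|k IH].
  - rewrite Nat.add_0_r; unfold minus; rewrite plus_opp_r norm_zero; lra.
  - rewrite Nat.add_succ_r.
    eapply Rle_trans; [apply (norm_minus_triangle _ (u (n + k)%nat))|].
    apply Rle_trans with ((d (n + k)%nat - d (S (n + k))) + (d n - d (n + k)%nat));
      [apply Rplus_le_compat; auto|lra]. }
assert (H0 : forall n, d n >= 0).
{ assert (Hdec : forall n k, d (n + k)%nat <= d n).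
  { intros n k; generalize (Hk n k) (norm_ge_0 (minus (u (n + k)%nat) (u n))); lra. }
  intros n; apply Rle_ge, (is_lim_seq_le_loc d (fun _ => d n) 0 (d n));
    [|exact Hd|apply is_lim_seq_const].
  exists n; intros m Hm; replace m with (n + (m - n))%nat by lia; apply Hdec. }
apply norm_cauchy_complete; intros e He.
destruct (proj1 (filterlim_norm_iff (V := R_NormedModule) d 0) Hd (e / 2)) as [N HN];
  [lra|].
exists N.
assert (HD : forall n, (N <= n)%nat -> norm (minus (u n) (u N)) < e / 2).
{ intros n Hn; replace n with (N + (n - N))%nat by lia.
  eapply Rle_lt_trans; [apply Hk|].
  specialize (HN N (le_n _)); specialize (H0 (N + (n - N))%nat).
  change (Rabs (d N + - 0) < e / 2) in HN.
  generalize (Rle_abs (d N + - 0)); lra. }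
intros n m Hn Hm; eapply Rle_lt_trans; [apply (norm_minus_triangle _ (u N))|].
rewrite -(opp_minus (u m) (u N)) (@norm_opp K V).
apply Rlt_le_trans with (e / 2 + e / 2); [|lra].
apply Rplus_lt_compat; [exact (HD n Hn)|exact (HD m Hm)].
Qed.


(** * Norms, square roots and automorphisms in a C*-algebra *)

Section CStar.
Context {A : CStarAlgebra}.

#[export] Instance cs_ring_ops :
  @Ring_ops A zero cs_one plus cs_mul minus opp eq := {}.
#[export] Instance cs_ring : Ncring.Ring (Ro := cs_ring_ops).
Proof.
constructor; try typeclasses eauto.
- apply (plus_zero_l (G := A)).
- apply (plus_comm (G := A)).
- apply (plus_assoc (G := A)).
- apply cs_mul_one_l.
- apply cs_mul_one_r.
- apply cs_mul_assoc.
- intros; apply cs_mul_plus_l.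
- intros; apply cs_mul_plus_r.
- reflexivity.
- apply (plus_opp_r (G := A)).
Qed.

Implicit Types a b c u y : A.

(* The Coquelicot lemmas restated on [A]: their instances carry other, convertible
   structure projections, which [lra] does not identify. *)
Lemma cs_norm_triangle a b : norm (plus a b) <= norm a + norm b.
Proof. exact (norm_triangle (V := A) a b). Qed.

Lemma cs_norm_ge_0 a : 0 <= norm a.
Proof. exact (norm_ge_0 (V := A) a). Qed.

Lemma cs_filterlim_iff (v : nat -> A) a : filterlim v eventually (locally a) <->
  forall e, 0 < e -> exists N, forall n, (N <= n)%nat -> norm (minus (v n) a) < e.
Proof. exact (filterlim_norm_iff (V := A) v a). Qed.

Lemma cs_mul_zero_l a : cs_mul zero a = zero.
Proof. non_commutative_ring. Qed.

Lemma cs_mul_zero_r a : cs_mul a zero = zero.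
Proof. non_commutative_ring. Qed.

Lemma norm_minus_sym a b : norm (minus a b) = norm (minus b a).
Proof. rewrite -norm_opp; f_equal; non_commutative_ring. Qed.

Lemma star_zero : cs_star (zero : A) = zero.
Proof.
transitivity (minus (cs_star (plus (zero : A) zero)) (cs_star (zero : A))).
- rewrite cs_star_plus; non_commutative_ring.
- rewrite plus_zero_l; non_commutative_ring.
Qed.

Lemma star_opp a : cs_star (opp a) = opp (cs_star a).
Proof.
transitivity (minus (cs_star (plus (opp a) a)) (cs_star a)).
- rewrite cs_star_plus; non_commutative_ring.
- rewrite plus_opp_l star_zero; non_commutative_ring.
Qed.

Lemma star_minus a b : cs_star (minus a b) = minus (cs_star a) (cs_star b).
Proof. unfold minus; rewrite cs_star_plus star_opp; reflexivity. Qed.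

Lemma star_one : cs_star (cs_one : A) = cs_one.
Proof.
rewrite -[LHS](cs_mul_one_l A) -{1}(cs_star_star A cs_one) -cs_star_mul.
rewrite cs_mul_one_l; apply cs_star_star.
Qed.

(** The C*-identity gives [norm b * norm b <= norm (cs_star b) * norm b]; cancel [norm b], then use
    the result for [a] and for [cs_star a]. *)
Lemma norm_star a : norm (cs_star a) = norm a.
Proof.
assert (H : forall b, norm b <= norm (cs_star b)).
{ intros b; generalize (cs_norm_star_mul A b) (cs_norm_mul A (cs_star b) b)
    (cs_norm_ge_0 b) (cs_norm_ge_0 (cs_star b)); intros E L Hb Hs.
  rewrite E in L.
  destruct (Rle_lt_or_eq_dec _ _ Hb) as [Hp|<-]; [|exact Hs].
  apply Rmult_le_reg_r in L; assumption. }
apply Rle_antisym; [|apply H].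
rewrite -{2}(cs_star_star A a); apply H.
Qed.

(** By the C*-identity the norm of the unit is its own square, hence at most 1, and it equals the
    square of [norm u]. The inequality also covers the zero algebra. *)
Lemma norm_unitary u : cs_mul (cs_star u) u = cs_one -> norm u <= 1.
Proof.
intros Hu.
assert (H1 := cs_norm_star_mul A cs_one).
rewrite star_one cs_mul_one_l in H1.
assert (H2 := cs_norm_star_mul A u); rewrite Hu in H2.
generalize (cs_norm_ge_0 cs_one) (cs_norm_ge_0 u); intros H3 H4.
assert (norm (cs_one : A) <= 1) by nra; nra.
Qed.

(* The limit [y] satisfies [(1 - y)^2 = 1 - c^2]. *)
Fixpoint sqrt_iter (c : A) (n : nat) : A :=
  match n with
  | O => zero
  | S n => scal (/ 2)%C (plus (cs_mul c c) (cs_mul (sqrt_iter c n) (sqrt_iter c n)))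
  end.

Lemma norm_half a : norm (scal (/ 2)%C a) = norm a / 2.
Proof.
assert (H2 : 2 <> 0) by lra.
rewrite norm_scal_eq -(RtoC_inv 2 H2) Cmod_R Rabs_pos_eq; lra.
Qed.

(** The bound [1 - sqrt (1 - r^2)] is the smaller fixed point of the scalar iteration
    [t -> (r^2 + t^2) / 2], so the induction reproduces it. *)
Lemma sqrt_iter_bound c r n : norm c <= r -> r <= 1 ->
  norm (sqrt_iter c n) <= 1 - sqrt (1 - r * r).
Proof.
intros Hc Hr; assert (H0 := norm_ge_0 c).
assert (Hs : sqrt (1 - r * r) * sqrt (1 - r * r) = 1 - r * r)
  by (apply sqrt_sqrt; nra).
assert (Hp := sqrt_pos (1 - r * r)).
induction n as [|n IH]; simpl.
- rewrite norm_zero; nra.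
- rewrite norm_half.
  generalize (cs_norm_triangle (cs_mul c c) (cs_mul (sqrt_iter c n) (sqrt_iter c n)))
    (cs_norm_mul A c c) (cs_norm_mul A (sqrt_iter c n) (sqrt_iter c n))
    (cs_norm_ge_0 (sqrt_iter c n)).
  set (y := sqrt_iter c n) in *; set (s := sqrt (1 - r * r)) in *; intros.
  assert (norm c * norm c <= r * r) by (apply Rmult_le_compat; lra).
  assert (norm y * norm y <= (1 - s) * (1 - s)) by (apply Rmult_le_compat; lra).
  lra.
Qed.

Lemma minus_sqr y z : minus (cs_mul y y) (cs_mul z z) =
  plus (cs_mul y (minus y z)) (cs_mul (minus y z) z).
Proof. non_commutative_ring. Qed.

(** Successive differences satisfy [(y^2 - z^2) / 2] with [y] and [z] of norm at most [q], so each
    step contracts by [(q + q) / 2 = q]. *)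
Lemma sqrt_iter_step c r q n : norm c <= r -> r <= 1 -> q = 1 - sqrt (1 - r * r) ->
  norm (minus (sqrt_iter c (S n)) (sqrt_iter c n)) <= q ^ n.
Proof.
intros Hc Hr Eq; assert (B := fun n => sqrt_iter_bound c r n Hc Hr).
rewrite -Eq in B; induction n as [|n IH].
- simpl sqrt_iter at 2; unfold minus; rewrite opp_zero plus_zero_r.
  apply Rle_trans with q; [apply B|]; simpl.
  generalize (sqrt_pos (1 - r * r)); lra.
- assert (E : minus (sqrt_iter c (S (S n))) (sqrt_iter c (S n)) =
    scal (/ 2)%C (minus (cs_mul (sqrt_iter c (S n)) (sqrt_iter c (S n)))
                   (cs_mul (sqrt_iter c n) (sqrt_iter c n)))).
  { change (minus (scal (/ 2)%C (plus (cs_mul c c)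
        (cs_mul (sqrt_iter c (S n)) (sqrt_iter c (S n)))))
      (scal (/ 2)%C (plus (cs_mul c c) (cs_mul (sqrt_iter c n) (sqrt_iter c n)))) =
      scal (/ 2)%C (minus (cs_mul (sqrt_iter c (S n)) (sqrt_iter c (S n)))
                   (cs_mul (sqrt_iter c n) (sqrt_iter c n)))).
    rewrite -(scal_minus_distr_l (V := A)); f_equal; non_commutative_ring. }
  rewrite E norm_half minus_sqr.
  set (y := sqrt_iter c (S n)) in *; set (z := sqrt_iter c n) in *.
  generalize (cs_norm_triangle (cs_mul y (minus y z)) (cs_mul (minus y z) z))
    (cs_norm_mul A y (minus y z)) (cs_norm_mul A (minus y z) z)
    (B (S n)) (B n) (cs_norm_ge_0 y) (cs_norm_ge_0 z) (cs_norm_ge_0 (minus y z)).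
  change (sqrt_iter c (S n)) with y; change (sqrt_iter c n) with z; intros.
  simpl pow.
  assert (norm y * norm (minus y z) <= q * q ^ n) by (apply Rmult_le_compat; auto).
  assert (norm (minus y z) * norm z <= q * q ^ n)
    by (rewrite Rmult_comm; apply Rmult_le_compat; auto).
  lra.
Qed.

Lemma cs_filterlim_plus (v w : nat -> A) a b :
  filterlim v eventually (locally a) -> filterlim w eventually (locally b) ->
  filterlim (fun n => plus (v n) (w n)) eventually (locally (plus a b)).
Proof.
intros Hv Hw.
eapply filterlim_comp_2; [exact Hv|exact Hw|].
exact (filterlim_plus (V := A) a b).
Qed.

Lemma filterlim_mul (u v : nat -> A) a b :
  filterlim u eventually (locally a) -> filterlim v eventually (locally b) ->
  filterlim (fun n => cs_mul (u n) (v n)) eventually (locally (cs_mul a b)).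
Proof.
intros Hu Hv; apply cs_filterlim_iff; intros e He.
assert (Ha := norm_ge_0 a); assert (Hb := norm_ge_0 b).
set (d := Rmin 1 (e / (norm a + norm b + 1))).
assert (Hd : 0 < d).
{ apply Rmin_glb_lt; [lra|]; apply Rdiv_lt_0_compat; lra. }
assert (Hd1 : d <= 1) by apply Rmin_l.
assert (Hd2 : d * (norm a + norm b + 1) <= e).
{ apply (Rmult_le_reg_r (/ (norm a + norm b + 1))); [apply Rinv_0_lt_compat; lra|].
  rewrite Rmult_assoc Rinv_r ?Rmult_1_r; [apply Rmin_r|lra]. }
destruct (proj1 (cs_filterlim_iff u a) Hu d Hd) as [N1 H1].
destruct (proj1 (cs_filterlim_iff v b) Hv d Hd) as [N2 H2].
exists (N1 + N2)%nat; intros n Hn.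
specialize (H1 n ltac:(lia)); specialize (H2 n ltac:(lia)).
replace (minus (cs_mul (u n) (v n)) (cs_mul a b)) with
  (plus (cs_mul (minus (u n) a) (minus (v n) b))
    (plus (cs_mul (minus (u n) a) b) (cs_mul a (minus (v n) b))))
  by non_commutative_ring.
set (x := minus (u n) a) in *; set (y := minus (v n) b) in *.
generalize (cs_norm_triangle (cs_mul x y) (plus (cs_mul x b) (cs_mul a y)))
  (cs_norm_triangle (cs_mul x b) (cs_mul a y)) (cs_norm_mul A x y) (cs_norm_mul A x b)
  (cs_norm_mul A a y) (cs_norm_ge_0 x) (cs_norm_ge_0 y); intros.
assert (norm x * norm y <= d * 1) by (apply Rmult_le_compat; lra).
nra.
Qed.

Lemma filterlim_star (u : nat -> A) a :
  filterlim u eventually (locally a) ->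
  filterlim (fun n => cs_star (u n)) eventually (locally (cs_star a)).
Proof.
intros Hu; apply cs_filterlim_iff; intros e He.
destruct (proj1 (cs_filterlim_iff u a) Hu e He) as [N H].
exists N; intros n Hn; rewrite -star_minus norm_star; auto.
Qed.

Lemma sqrt_iter_star c n : cs_star c = c -> cs_star (sqrt_iter c n) = sqrt_iter c n.
Proof.
intros Hc; induction n as [|n IH]; simpl; [apply star_zero|].
rewrite cs_star_scal cs_star_plus !cs_star_mul Hc IH; f_equal.
apply injective_projections; simpl; field.
Qed.

Lemma sqrt_iter_comm c n : cs_mul c (sqrt_iter c n) = cs_mul (sqrt_iter c n) c.
Proof.
induction n as [|n IH]; simpl; [non_commutative_ring|].
rewrite cs_mul_scal_l cs_mul_scal_r cs_mul_plus_l cs_mul_plus_r.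
do 2 f_equal; [non_commutative_ring|].
rewrite cs_mul_assoc IH -cs_mul_assoc IH cs_mul_assoc; reflexivity.
Qed.

(** The strict bound on [norm c] makes the ratio [q] less than 1. The last equation is the
    fixed-point equation doubled; it says that [1 - y] is a square root of [1 - c^2]. *)
Lemma sqrt_exists c : cs_star c = c -> norm c < 1 -> exists y,
  cs_star y = y /\ cs_mul c y = cs_mul y c /\
  plus y y = plus (cs_mul c c) (cs_mul y y).
Proof.
intros Hs Hc; assert (H0 := norm_ge_0 c).
set (q := 1 - sqrt (1 - norm c * norm c)).
assert (Hq0 : 0 < sqrt (1 - norm c * norm c)) by (apply sqrt_lt_R0; nra).
assert (Hq1 : sqrt (1 - norm c * norm c) <= 1).
{ rewrite -{2}sqrt_1; apply sqrt_le_1_alt; nra. }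
destruct (telescoping_converges (sqrt_iter c) (fun n => q ^ n / (1 - q))) as [y Hy].
- intros n; eapply Rle_trans.
  + apply (sqrt_iter_step c (norm c) q n); [lra|lra|reflexivity].
  + right; simpl; field; unfold q; lra.
- replace (Finite 0) with (Rbar_mult 0 (/ (1 - q))) by (simpl; f_equal; ring).
  apply is_lim_seq_scal_r, is_lim_seq_geom; rewrite Rabs_pos_eq; unfold q; lra.
- assert (UL := fun (w : nat -> A) (l l' : A) =>
    filterlim_locally_unique (F := eventually) w l l').
  exists y; split; [|split].
  + apply (UL (fun n => cs_star (sqrt_iter c n))); [apply filterlim_star, Hy|].
    apply (filterlim_ext (sqrt_iter c)); [|exact Hy].
    intros n; symmetry; apply sqrt_iter_star, Hs.
  + apply (UL (fun n => cs_mul c (sqrt_iter c n))).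
    * apply (filterlim_mul (fun _ => c)); [apply filterlim_const|exact Hy].
    * apply (filterlim_ext (fun n => cs_mul (sqrt_iter c n) c)).
      { intros n; symmetry; apply sqrt_iter_comm. }
      apply (filterlim_mul _ (fun _ => c)); [exact Hy|apply filterlim_const].
  + apply (UL (fun n => plus (sqrt_iter c (S n)) (sqrt_iter c (S n)))).
    * apply cs_filterlim_plus;
        (apply (filterlim_comp _ _ _ S _ _ eventually); [|exact Hy];
         apply eventually_subseq; intros; lia).
    * apply (filterlim_ext
        (fun n => plus (cs_mul c c) (cs_mul (sqrt_iter c n) (sqrt_iter c n)))).
      { intros n; simpl; rewrite -(scal_distr_r (V := A)).
        rewrite -[LHS](scal_one (V := A)); f_equal.
        apply injective_projections; simpl; field. }
      apply cs_filterlim_plus; [apply filterlim_const|].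
      apply filterlim_mul; exact Hy.
Qed.

Section Automorphism.
Context (f : A -> A) (Hf : star_automorphism f).

(** Unitality comes from surjectivity: if [f e = 1], then [f 1 = f 1 * f e = f e = 1]. *)
Lemma aut_one : f cs_one = cs_one.
Proof.
destruct (aut_bij _ Hf cs_one) as [e [He _]].
rewrite -[LHS](cs_mul_one_r A) -{2}He -(aut_mul _ Hf) cs_mul_one_l; exact He.
Qed.

Lemma aut_unitary_norm u : cs_mul (cs_star u) u = cs_one -> norm (f u) <= 1.
Proof.
intros Hu; apply norm_unitary.
rewrite -(aut_star _ Hf) -(aut_mul _ Hf) Hu; exact aut_one.
Qed.

(* [c = (u + u^* ) / 2] with [u = c + i sqrt (1 - c^2)] unitary. *)
Lemma aut_self_adjoint_norm_le_1 c : cs_star c = c -> norm c < 1 -> norm (f c) <= 1.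
Proof.
intros Hs Hc; destruct (sqrt_exists c Hs Hc) as [y [Ys [Yc Yq]]].
pose (s := minus cs_one y : A).
assert (Hss : cs_star s = s) by (unfold s; rewrite star_minus star_one Ys; reflexivity).
assert (Hcs : cs_mul c s = cs_mul s c).
{ unfold s; transitivity (minus c (cs_mul c y)); [non_commutative_ring|].
  rewrite Yc; non_commutative_ring. }
assert (H1 : plus (cs_mul c c) (cs_mul s s) = cs_one).
{ unfold s; transitivity
    (plus cs_one (minus (plus (cs_mul c c) (cs_mul y y)) (plus y y)));
    [non_commutative_ring|]. rewrite -Yq; non_commutative_ring. }
(* Here [k] stands for [i] and for [-i]. As [c] and [s] commute, the cross terms of [u^* u] are
   [(conj k + k) s c = 0], which leaves [c^2 + s^2 = 1]. *)
assert (Hu : forall k : C, Cmult (Cconj k) k = 1%C -> Cplus (Cconj k) k = 0%C ->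
  norm (f (plus c (scal k s))) <= 1).
{ intros k K1 K0; apply aut_unitary_norm.
  rewrite cs_star_plus cs_star_scal Hs Hss.
  rewrite cs_mul_plus_l !cs_mul_plus_r !cs_mul_scal_l !cs_mul_scal_r.
  rewrite scal_assoc; change (mult (Cconj k) k) with (Cmult (Cconj k) k).
  rewrite K1 (scal_one (V := A)) -H1 Hcs.
  set (z := cs_mul s c); set (a := cs_mul c c); set (b := cs_mul s s).
  transitivity (plus (plus a b) (plus (scal (Cconj k) z) (scal k z))).
  - change (scal (k : C_AbsRing) z) with (scal k z).
    generalize (scal k z) (scal (Cconj k) z); intros; non_commutative_ring.
  - rewrite -(scal_distr_r (V := A)).
    change (plus (Cconj k) k) with (Cplus (Cconj k) k); rewrite K0.
    rewrite (scal_zero_l (V := A)) plus_zero_r; reflexivity. }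
assert (Hi := Hu Ci ltac:(apply injective_projections; simpl; ring)
  ltac:(apply injective_projections; simpl; ring)).
assert (Hj := Hu (- Ci)%C ltac:(apply injective_projections; simpl; ring)
  ltac:(apply injective_projections; simpl; ring)).
assert (E : c = scal (/ 2)%C (plus (plus c (scal Ci s)) (plus c (scal (- Ci)%C s)))).
{ transitivity (scal (/ 2)%C (plus c c)).
  - etransitivity; [|symmetry; exact (scal_distr_l (V := A) (/ 2)%C c c)].
    rewrite -(scal_distr_r (V := A)).
    rewrite -[LHS](scal_one (V := A)); f_equal.
    apply injective_projections; simpl; field.
  - f_equal; transitivity (plus (plus c c) (scal (Ci + - Ci)%C s)).
    + replace (Ci + - Ci)%C with (zero : C_AbsRing)
        by (apply injective_projections; simpl; ring).
      rewrite (scal_zero_l (V := A)) plus_zero_r; reflexivity.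
    + transitivity (plus (plus c c) (plus (scal Ci s) (scal (- Ci)%C s)));
        [|non_commutative_ring].
      f_equal; exact (scal_distr_r (V := A) Ci (- Ci)%C s). }
rewrite E (aut_scal _ Hf) (aut_plus _ Hf) norm_half.
eapply Rle_trans; [apply Rmult_le_compat_r; [lra|apply cs_norm_triangle]|]; lra.
Qed.

(** For self-adjoint [c], an [r] strictly between [norm c] and [norm (f c)] would make [c / r]
    violate the unit-ball case. The general case applies this to [a^* a], whose norm is the square
    of that of [a]. *)
Lemma aut_contractive a : norm (f a) <= norm a.
Proof.
assert (Hsa : forall c, cs_star c = c -> norm (f c) <= norm c).
{ intros c Hs; apply Rnot_lt_le; intros Hlt.
  set (r := (norm c + norm (f c)) / 2).
  assert (Hr : norm c < r < norm (f c)) by (unfold r; lra).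
  assert (Hc := norm_ge_0 c).
  assert (Hn : forall b, norm (scal (RtoC (/ r)) b) = / r * norm b).
  { intros b; rewrite norm_scal_eq Cmod_R Rabs_pos_eq; [reflexivity|].
    left; apply Rinv_0_lt_compat; lra. }
  assert (H : norm (f (scal (RtoC (/ r)) c)) <= 1).
  { apply aut_self_adjoint_norm_le_1.
    - rewrite cs_star_scal Hs; f_equal; apply injective_projections; simpl; ring.
    - rewrite Hn; apply (Rmult_lt_reg_l r); [lra|].
      rewrite -Rmult_assoc Rinv_r ?Rmult_1_l ?Rmult_1_r; lra. }
  rewrite (aut_scal _ Hf) Hn in H.
  apply (Rmult_le_compat_l r) in H; [|lra].
  rewrite -Rmult_assoc Rinv_r in H; lra. }
assert (H := Hsa (cs_mul (cs_star a) a)).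
rewrite cs_star_mul cs_star_star (aut_mul _ Hf) (aut_star _ Hf) in H.
rewrite !cs_norm_star_mul in H; specialize (H eq_refl).
apply Rsqr_incr_0; [exact H|apply cs_norm_ge_0|apply cs_norm_ge_0].
Qed.

End Automorphism.

(** Contractivity is used for [al t] and for its inverse [al (- t)]. *)
Lemma norm_act (al : CircleAction A) t a : norm (al t a) = norm a.
Proof.
apply Rle_antisym; [apply aut_contractive, act_aut|].
rewrite -{1}(act_zero A al a) -(Rplus_opp_l t) act_add.
apply aut_contractive, act_aut.
Qed.

End CStar.

(** * Bounded real-linear maps and calculus *)

Section BoundedLinear.
Context {U V : CompleteNormedModule R_AbsRing}.

Lemma is_derive_linear (L : U -> V) (f : R -> U) t l :
  is_linear L -> is_derive f t l -> is_derive (fun s => L (f s)) t (L l).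
Proof.
intros HL Hf; unfold is_derive.
eapply filterdiff_ext_lin.
- apply (filterdiff_comp' f L t _ L Hf), filterdiff_linear, HL.
- intros s; simpl; apply (linear_scal L HL).
Qed.

Lemma continuous_linear (L : U -> V) (f : R -> U) t :
  is_linear L -> continuous f t -> continuous (fun s => L (f s)) t.
Proof.
intros HL Hf; apply (continuous_comp f L); [exact Hf|exact (linear_cont L (f t) HL)].
Qed.

Lemma Cn_linear (L : U -> V) n (f : R -> U) :
  is_linear L -> Cn n f -> Cn n (fun s => L (f s)).
Proof.
intros HL; revert f; induction n as [|n IH]; intros f; simpl.
- intros Hf t; apply continuous_linear; auto.
- intros [f' [Hf Hf']]; exists (fun s => L (f' s)); split; auto.
  intros t; apply is_derive_linear; auto.
Qed.

(* Through the fundamental theorem of calculus. *)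
Lemma RInt_linear (L : U -> V) (f : R -> U) a b :
  is_linear L -> (forall t, continuous f t) ->
  RInt (fun t => L (f t)) a b = L (RInt f a b).
Proof.
intros HL Hf; apply is_RInt_unique.
assert (HI : forall c d, ex_RInt f c d)
  by (intros; apply ex_RInt_continuous; auto).
replace (L (RInt f a b)) with (minus (L (RInt f a b)) (L (RInt f a a))).
- apply (is_RInt_derive (fun t => L (RInt f a t))); intros t _.
  + apply is_derive_linear; [exact HL|].
    apply (is_derive_RInt f _ a t); [|apply Hf].
    apply filter_forall; intros s; apply RInt_correct, HI.
  + apply continuous_linear; auto.
- rewrite RInt_point.
  replace (L zero) with (zero : V); [|symmetry; exact (linear_zero L HL)].
  unfold minus; rewrite opp_zero plus_zero_r; reflexivity.
Qed.

End BoundedLinear.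

(** The difference is the zero function with derivative [z = l - l']. If [z] were not zero,
    tolerance [norm z / 2] at increment [d / 2] would give [norm z <= norm z / 2]. *)
Lemma derive_unique {V : NormedModule R_AbsRing} (f : R -> V) t l l' :
  is_derive f t l -> is_derive f t l' -> l = l'.
Proof.
intros H H'.
assert (H0 := is_derive_minus f f t l l' H H').
apply (is_derive_ext _ (fun _ => zero : V)) in H0;
  [|intros s; apply (plus_opp_r (f s))].
destruct H0 as [_ H0]; specialize (H0 t (fun P HP => HP)).
assert (E : norm (minus l l') <= 0).
{ apply Rnot_lt_le; intros Hlt.
  destruct (H0 (mkposreal (norm (minus l l') / 2) ltac:(lra))) as [d Hd].
  assert (Hp := cond_pos d).
  specialize (Hd (t + d / 2)); simpl in Hd.
  assert (Hb : ball t d (t + d / 2)).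
  { change (Rabs (t + d / 2 + - t) < d); rewrite Rabs_pos_eq; lra. }
  specialize (Hd Hb).
  assert (Em : minus (t + d / 2) t = d / 2).
  { change (t + d / 2 + - t = d / 2); ring. }
  rewrite Em in Hd.
  change (norm (d / 2)) with (Rabs (d / 2)) in Hd.
  rewrite Rabs_pos_eq in Hd; [|lra].
  set (z := minus l l') in *.
  assert (E : norm (scal (d / 2) z) <= norm z / 2 * (d / 2)).
  { rewrite -(norm_opp (V := V)); eapply Rle_trans; [right|exact Hd].
    f_equal; unfold minus; rewrite opp_zero !plus_zero_l; reflexivity. }
  (* [norm_scal] is an inequality, so a lower bound for the norm of [(d / 2) z] is obtained by
     scaling back with [2 / d]. *)
  assert (H2 := norm_scal (V := V) (2 / d) (scal (d / 2) z)).
  change (abs (2 / d)) with (Rabs (2 / d)) in H2.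
  rewrite Rabs_pos_eq in H2; [|left; apply Rdiv_lt_0_compat; lra].
  rewrite scal_assoc in H2; change (mult (2 / d) (d / 2)) with (2 / d * (d / 2)) in H2.
  replace (2 / d * (d / 2)) with 1 in H2 by (field; lra).
  change 1 with (one : R_Ring) in H2.
  rewrite scal_one in H2.
  assert (H3 : 2 / d * norm (scal (d / 2) z) <= 2 / d * (norm z / 2 * (d / 2))).
  { apply Rmult_le_compat_l; [left; apply Rdiv_lt_0_compat; lra|exact E]. }
  replace (2 / d * (norm z / 2 * (d / 2))) with (norm z / 2) in H3 by (field; lra).
  lra. }
assert (E0 : norm (minus l l') = 0).
{ apply Rle_antisym; [exact E|apply norm_ge_0]. }
apply norm_eq_zero in E0.
rewrite -(plus_zero_r l) -(plus_opp_l l') plus_assoc.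
change (plus l (opp l')) with (minus l l'); rewrite E0 plus_zero_l; reflexivity.
Qed.

Lemma vderive_eq {V : CompleteNormedModule R_AbsRing} (f : R -> V) t l :
  is_derive f t l -> vderive f t = l.
Proof.
intros H; apply iota_unique; [|exact H].
intros y Hy; apply (derive_unique f t); assumption.
Qed.

(** The shifted interval splits at 0 and [T]; by periodicity the outer pieces are integrals over the
    same interval in opposite directions. *)
Lemma RInt_periodic {V : CompleteNormedModule R_AbsRing} (h : R -> V) (T s : R) :
  (forall t, continuous h t) -> (forall t, h (t + T) = h t) ->
  RInt (fun t => h (t + s)) 0 T = RInt h 0 T.
Proof.
intros Hc Hp.
assert (HI : forall c d, ex_RInt h c d)
  by (intros; apply ex_RInt_continuous; auto).
assert (Hs : forall v a b, RInt (fun t => h (t + v)) a b = RInt h (a + v) (b + v)).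
{ intros v a b.
  transitivity (RInt (fun y => scal 1 (h (1 * y + v))) a b).
  - apply RInt_ext; intros x _; rewrite Rmult_1_l.
    symmetry; exact (scal_one (h (x + v))).
  - rewrite RInt_comp_lin; [rewrite !Rmult_1_l; reflexivity|apply HI]. }
assert (HT : RInt h T (T + s) = RInt h 0 s).
{ transitivity (RInt (fun t => h (t + T)) 0 s).
  - rewrite Hs Rplus_0_l (Rplus_comm s); reflexivity.
  - apply RInt_ext; auto. }
rewrite Hs Rplus_0_l.
rewrite -(RInt_Chasles h s 0 (T + s)); [|apply HI|apply HI].
rewrite -(RInt_Chasles h 0 T (T + s)); [|apply HI|apply HI].
rewrite HT -(opp_RInt_swap h 0 s); [|apply HI].
rewrite (plus_comm (RInt h 0 T)) plus_assoc plus_opp_l plus_zero_l; reflexivity.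
Qed.

(** * Characters of the circle and bounded real-linear operators on the algebra *)

Lemma cis_plus x y : cis (x + y) = (cis x * cis y)%C.
Proof.
unfold cis, Cmult; simpl; rewrite cos_plus sin_plus; f_equal; ring.
Qed.

Lemma cis_0 : cis 0 = RtoC 1.
Proof. unfold cis; rewrite cos_0 sin_0; reflexivity. Qed.

Lemma cis_PI : cis PI = RtoC (- 1).
Proof. unfold cis; rewrite cos_PI sin_PI; reflexivity. Qed.

Lemma cis_opp x : cis (- x) = Cconj (cis x).
Proof. unfold cis, Cconj; rewrite cos_neg sin_neg; reflexivity. Qed.

Lemma Cmod_cis x : Cmod (cis x) = 1.
Proof.
unfold Cmod, cis; simpl fst; simpl snd.
replace (cos x ^ 2 + sin x ^ 2) with 1; [apply sqrt_1|].
rewrite -(sin2_cos2 x); unfold Rsqr; ring.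
Qed.

Lemma cis_period (m : Z) : cis (IZR m * (2 * PI)) = RtoC 1.
Proof.
assert (Hn : forall n, cis (INR n * (2 * PI)) = RtoC 1).
{ intros n; unfold cis; replace (INR n * (2 * PI)) with (0 + 2 * INR n * PI) by ring.
  rewrite cos_period sin_period cos_0 sin_0; reflexivity. }
destruct (Z_le_gt_dec 0 m) as [Hm|Hm].
- rewrite -(Z2Nat.id m Hm) -INR_IZR_INZ; apply Hn.
- replace (IZR m * (2 * PI)) with (- (INR (Z.to_nat (- m)) * (2 * PI))).
  + rewrite cis_opp Hn; apply injective_projections; simpl; ring.
  + rewrite INR_IZR_INZ Z2Nat.id ?opp_IZR; [ring|lia].
Qed.

Section RealLinear.
Context {A : CStarAlgebra}.
Implicit Types (a b x y : A) (L : A -> A).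

(** Linearity over the reals covers the conjugate-linear involution along with multiplications, the
    action and the Fourier projections, and it is what differentiation and integration in
    [realify A] respect. *)
Definition real_linear L : Prop :=
  is_linear (K := R_AbsRing) (U := realify A) (V := realify A) L.

Lemma real_linear_intro L (M : R) :
  (forall x y, L (plus x y) = plus (L x) (L y)) ->
  (forall (k : R) x, L (scal (RtoC k) x) = scal (RtoC k) (L x)) ->
  (forall x, norm (L x) <= M * norm x) -> real_linear L.
Proof.
intros Hp Hs HM; split; [exact Hp|exact Hs|].
exists (Rabs M + 1); split; [generalize (Rabs_pos M); lra|].
intros x; apply Rle_trans with (M * norm x); [apply HM|].
apply Rmult_le_compat_r; [apply cs_norm_ge_0|generalize (Rle_abs M); lra].
Qed.

Lemma real_linear_bound L : real_linear L -> exists M, 0 < M /\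
  forall x, norm (L x) <= M * norm x.
Proof. intros [_ _ H]; exact H. Qed.

Lemma real_linear_plus L x y : real_linear L -> L (plus x y) = plus (L x) (L y).
Proof. intros H; exact (linear_plus (U := realify A) (V := realify A) L H x y). Qed.

Lemma real_linear_minus L x y : real_linear L -> L (minus x y) = minus (L x) (L y).
Proof. intros H; exact (linear_minus (U := realify A) (V := realify A) L x y H). Qed.

Lemma real_linear_zero L : real_linear L -> L zero = zero.
Proof. intros H; exact (linear_zero (U := realify A) (V := realify A) L H). Qed.

Lemma real_linear_comp L L' : real_linear L -> real_linear L' ->
  real_linear (fun x => L' (L x)).
Proof. intros H H'; exact (is_linear_comp (U := realify A) (V := realify A) (W := realify A) L L' H H'). Qed.

Lemma real_linear_star : real_linear cs_star.
Proof.
apply (real_linear_intro _ 1).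
- apply cs_star_plus.
- intros k x; rewrite cs_star_scal; f_equal.
  apply injective_projections; simpl; ring.
- intros x; rewrite norm_star; lra.
Qed.

Lemma real_linear_mul_l a : real_linear (cs_mul a).
Proof.
apply (real_linear_intro _ (norm a)).
- apply cs_mul_plus_r.
- intros k x; apply cs_mul_scal_r.
- apply cs_norm_mul.
Qed.

Lemma real_linear_mul_r a : real_linear (fun x => cs_mul x a).
Proof.
apply (real_linear_intro _ (norm a)).
- intros; apply cs_mul_plus_l.
- intros k x; apply cs_mul_scal_l.
- intros x; rewrite Rmult_comm; apply cs_norm_mul.
Qed.

Lemma cs_scal_assoc (j k : C) a : scal j (scal k a) = scal (Cmult j k) a.
Proof. exact (scal_assoc (V := A) j k a). Qed.

Lemma cs_scal_distr_r (j k : C) a :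
  scal (Cplus j k) a = plus (scal j a) (scal k a).
Proof. exact (scal_distr_r (V := A) j k a). Qed.

Lemma cs_scal_plus (k : C) a b : scal k (plus a b) = plus (scal k a) (scal k b).
Proof. exact (scal_distr_l (V := A) k a b). Qed.

Lemma cs_scal_minus (k : C) a b : scal k (minus a b) = minus (scal k a) (scal k b).
Proof. exact (scal_minus_distr_l (V := A) k a b). Qed.

Lemma cs_scal_zero (k : C) : scal k (zero : A) = zero.
Proof. exact (scal_zero_r (V := A) k). Qed.

Lemma cs_scal_1 a : scal (RtoC 1) a = a.
Proof. exact (scal_one (V := A) a). Qed.

Lemma cs_norm_scal (k : C) a : norm (scal k a) = Cmod k * norm a.
Proof. exact (norm_scal_eq (V := A) k a). Qed.

Lemma real_linear_scal (k : C) : real_linear (scal k).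
Proof.
apply (real_linear_intro _ (Cmod k)).
- intros; apply cs_scal_plus.
- intros j x; rewrite !cs_scal_assoc Cmult_comm; reflexivity.
- intros x; right; apply cs_norm_scal.
Qed.

(** Rewrites a complex phase as real multiples of [a] and [i a], so that continuity and
    differentiation over real scalars apply to it. *)
Lemma cis_scal (r : R) a :
  scal (cis r) a = plus (scal (RtoC (cos r)) a) (scal (RtoC (sin r)) (scal Ci a)).
Proof.
rewrite cs_scal_assoc -cs_scal_distr_r; f_equal.
apply injective_projections; simpl; ring.
Qed.

Lemma continuous_cis_scal (g : R -> R) (f : R -> A) t :
  continuous g t -> continuous (f : R -> realify A) t ->
  continuous (fun s => scal (cis (g s)) (f s) : realify A) t.
Proof.
intros Hg Hf.
apply (continuous_ext (fun s =>
  plus (scal (cos (g s)) (f s : realify A)) (scal (sin (g s)) (scal Ci (f s) : realify A)))).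
{ intros s; symmetry; exact (cis_scal (g s) (f s)). }
apply (continuous_plus (V := realify A)).
- apply (continuous_scal (V := realify A)); [|exact Hf].
  apply continuous_cos_comp, Hg.
- apply (continuous_scal (V := realify A)).
  + apply continuous_sin_comp, Hg.
  + apply (continuous_linear (U := realify A) (V := realify A) (scal Ci) f t);
      [apply real_linear_scal|exact Hf].
Qed.

End RealLinear.

(** * Fourier projections *)

Section Fourier.
Context {A : CStarAlgebra} (al : CircleAction A).
Implicit Types (a b x y : A) (L : A -> A) (m k : Z).

Lemma act_plus t a b : al t (plus a b) = plus (al t a) (al t b).
Proof. apply (aut_plus _ (act_aut A al t)). Qed.

Lemma act_scal t (k : C) a : al t (scal k a) = scal k (al t a).
Proof. apply (aut_scal _ (act_aut A al t)). Qed.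

Lemma act_mul t a b : al t (cs_mul a b) = cs_mul (al t a) (al t b).
Proof. apply (aut_mul _ (act_aut A al t)). Qed.

Lemma act_star t a : al t (cs_star a) = cs_star (al t a).
Proof. apply (aut_star _ (act_aut A al t)). Qed.

Lemma act_comm s t a : al s (al t a) = al t (al s a).
Proof. rewrite -!act_add Rplus_comm; reflexivity. Qed.

Lemma real_linear_act t : real_linear (al t).
Proof.
apply (real_linear_intro _ 1).
- apply act_plus.
- intros k x; apply act_scal.
- intros x; rewrite norm_act; lra.
Qed.

Lemma continuous_orbit a t : continuous (fun s => al s a : realify A) t.
Proof. exact (act_continuous A al a t). Qed.

(* [fourier_proj] on all of [A]. *)
Definition fourier m a : A :=
  scal (RtoC (/ (2 * PI)))
    (RInt (V := realify A) (fun t => scal (cis (- (IZR m * t))) (al t a)) 0 (2 * PI)).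

Definition has_weight m a : Prop := forall t, al t a = scal (cis (IZR m * t)) a.

Lemma continuous_fourier_integrand m a t :
  continuous (fun t => scal (cis (- (IZR m * t))) (al t a) : realify A) t.
Proof.
apply (continuous_cis_scal (fun t => - (IZR m * t)) (fun t => al t a)).
- apply (continuous_opp (V := R_NormedModule)).
  apply (continuous_scal_r (V := R_NormedModule) (IZR m)), continuous_id.
- apply continuous_orbit.
Qed.

Lemma fourier_integrable m a c d :
  ex_RInt (fun t => scal (cis (- (IZR m * t))) (al t a) : realify A) c d.
Proof.
apply ex_RInt_continuous; intros t _; apply continuous_fourier_integrand.
Qed.

(** The interchange of a bounded operator with the Fourier integral. With [L] the action, a scalar,
    the involution or a left multiplication, it yields the transformation rules of [fourier]. *)
Lemma fourier_real_linear L m a (g : R -> A) : real_linear L ->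
  (forall (r : R) x, L (scal (RtoC r) x) = scal (RtoC r) (L x)) ->
  (forall t, L (scal (cis (- (IZR m * t))) (al t a)) = g t) ->
  L (fourier m a) = scal (RtoC (/ (2 * PI))) (RInt (V := realify A) g 0 (2 * PI)).
Proof.
intros HL Hs Hg; unfold fourier; rewrite Hs; f_equal; symmetry.
etransitivity; [|apply (RInt_linear (U := realify A) (V := realify A) L);
  [exact HL|apply continuous_fourier_integrand]].
apply (RInt_ext (V := realify A)); intros t _; symmetry; apply Hg.
Qed.

Lemma act_fourier m s a : al s (fourier m a) = fourier m (al s a).
Proof.
apply fourier_real_linear; [apply real_linear_act|intros; apply act_scal|].
intros t; rewrite act_scal act_comm; reflexivity.
Qed.

(** Applying [al s] shifts the orbit by [s]; writing [e^(-imt) = e^(ims) e^(-im(t+s))] turns the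
    integrand into [e^(ims)] times a translate of the original one, and the integral over a period
    ignores translations. *)
Lemma has_weight_fourier m a : has_weight m (fourier m a).
Proof.
intros s; rewrite act_fourier.
rewrite (fourier_real_linear (scal (cis (IZR m * s))) m a
  (fun t => scal (cis (IZR m * s)) (scal (cis (- (IZR m * t))) (al t a)))).
- unfold fourier; f_equal.
  set (h := fun t => scal (cis (IZR m * s)) (scal (cis (- (IZR m * t))) (al t a))
    : realify A).
  transitivity (RInt (fun t => h (t + s)) 0 (2 * PI)).
  + apply (RInt_ext (V := realify A)); intros t _; unfold h.
    rewrite cs_scal_assoc -cis_plus act_add; do 2 f_equal; ring.
  + apply RInt_periodic.
    * intros t; apply (continuous_linear (U := realify A) (V := realify A)
        (scal (cis (IZR m * s)))); [apply real_linear_scal|].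
      apply continuous_fourier_integrand.
    * intros t; unfold h; rewrite act_add act_period; do 2 f_equal.
      rewrite Rmult_plus_distr_l Ropp_plus_distr cis_plus (cis_opp (IZR m * (2 * PI))).
      rewrite cis_period; apply injective_projections; simpl; ring.
- apply real_linear_scal.
- intros k x; rewrite !cs_scal_assoc Cmult_comm; reflexivity.
- reflexivity.
Qed.

Lemma norm_fourier m a : norm (fourier m a) <= norm a.
Proof.
unfold fourier; rewrite cs_norm_scal Cmod_R.
assert (HP := PI_RGT_0).
rewrite Rabs_pos_eq; [|left; apply Rinv_0_lt_compat; lra].
assert (H := norm_RInt_le_const (V := realify A)
  (fun t => scal (cis (- (IZR m * t))) (al t a)) 0 (2 * PI)
  (RInt (V := realify A) (fun t => scal (cis (- (IZR m * t))) (al t a)) 0 (2 * PI))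
  (norm a) ltac:(lra)).
apply (Rmult_le_reg_l (2 * PI)); [lra|].
rewrite -Rmult_assoc Rinv_r ?Rmult_1_l; [|lra].
rewrite Rminus_0_r in H; apply H.
- intros t _; right.
  transitivity (norm (scal (cis (- (IZR m * t))) (al t a))); [reflexivity|].
  rewrite cs_norm_scal Cmod_cis norm_act; ring.
- apply RInt_correct, fourier_integrable.
Qed.

Lemma fourier_plus m a b : fourier m (plus a b) = plus (fourier m a) (fourier m b).
Proof.
unfold fourier; rewrite -cs_scal_plus; f_equal.
etransitivity; [|apply (RInt_plus (V := realify A)); apply fourier_integrable].
apply (RInt_ext (V := realify A)); intros t _; rewrite act_plus; apply cs_scal_plus.
Qed.

Lemma fourier_scal m (k : C) a : fourier m (scal k a) = scal k (fourier m a).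
Proof.
symmetry; apply fourier_real_linear; [apply real_linear_scal| |].
- intros j x; rewrite !cs_scal_assoc Cmult_comm; reflexivity.
- intros t; rewrite act_scal !cs_scal_assoc Cmult_comm; reflexivity.
Qed.

Lemma real_linear_fourier m : real_linear (fourier m).
Proof.
apply (real_linear_intro _ 1).
- apply fourier_plus.
- intros k x; apply fourier_scal.
- intros x; rewrite Rmult_1_l; apply norm_fourier.
Qed.

Lemma fourier_star m a : fourier m (cs_star a) = cs_star (fourier (- m) a).
Proof.
symmetry; apply fourier_real_linear; [apply real_linear_star| |].
- intros j x; rewrite cs_star_scal; f_equal.
  apply injective_projections; simpl; ring.
- intros t; rewrite act_star cs_star_scal -cis_opp opp_IZR; do 2 f_equal; ring.
Qed.

Lemma fourier_mul_weight k m x y :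
  has_weight k x -> fourier m (cs_mul x y) = cs_mul x (fourier (m - k) y).
Proof.
intros Hx; symmetry; apply (fourier_real_linear (cs_mul x)).
- apply real_linear_mul_l.
- intros; apply cs_mul_scal_r.
- intros t; rewrite act_mul Hx cs_mul_scal_r cs_mul_scal_l cs_scal_assoc -cis_plus.
  rewrite minus_IZR; do 2 f_equal; ring.
Qed.

Lemma fourier_of_weight m x : has_weight m x -> fourier m x = x.
Proof.
intros Hx; unfold fourier.
transitivity (scal (RtoC (/ (2 * PI))) (RInt (fun _ => x : realify A) 0 (2 * PI))).
- f_equal; apply (RInt_ext (V := realify A)); intros t _; rewrite Hx cs_scal_assoc -cis_plus.
  rewrite Rplus_opp_l cis_0; apply cs_scal_1.
- rewrite RInt_const Rminus_0_r.
  transitivity (scal (RtoC (/ (2 * PI))) (scal (RtoC (2 * PI)) x)); [reflexivity|].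
  rewrite cs_scal_assoc -RtoC_mult Rinv_l; [apply cs_scal_1|].
  generalize PI_RGT_0; lra.
Qed.

Lemma opp_eq_zero a : a = scal (RtoC (- 1)) a -> a = zero.
Proof.
intros H; assert (E : norm (scal (RtoC 2) a) = 0).
{ replace (scal (RtoC 2) a) with (zero : A); [exact (norm_zero (V := A))|].
  rewrite (_ : RtoC 2 = RtoC 1 + RtoC 1)%C;
    [|apply injective_projections; simpl; ring].
  rewrite cs_scal_distr_r cs_scal_1 {1}H -{2}(cs_scal_1 a) -cs_scal_distr_r.
  replace (RtoC (- 1) + RtoC 1)%C with (zero : C_Ring)
    by (apply injective_projections; simpl; ring).
  symmetry; apply (scal_zero_l (V := A)). }
rewrite cs_norm_scal Cmod_R Rabs_pos_eq in E; [|lra].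
apply (norm_eq_zero (V := A)).
generalize (cs_norm_ge_0 a); intros; change (norm a = 0); lra.
Qed.

(** On [fourier k x], [al s] acts by [e^(iks)] because of its weight and by [e^(ims)] because the
    projection commutes with the action. At [s = PI / (k - m)] these phases differ by the factor
    -1. *)
Lemma fourier_of_other_weight k m x : k <> m -> has_weight m x -> fourier k x = zero.
Proof.
intros Hk Hx; apply opp_eq_zero.
assert (Hd : IZR (k - m) <> 0) by (apply not_0_IZR; lia).
set (s := PI / IZR (k - m)).
assert (E : scal (cis (IZR k * s)) (fourier k x) = scal (cis (IZR m * s)) (fourier k x)).
{ rewrite -has_weight_fourier act_fourier Hx fourier_scal; reflexivity. }
move: (fourier k x) E => z E.
apply (f_equal (scal (cis (- (IZR m * s))))) in E.
rewrite !cs_scal_assoc -!cis_plus Rplus_opp_l cis_0 cs_scal_1 in E.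
rewrite -{1}E; f_equal; rewrite -cis_PI; f_equal.
unfold s; rewrite minus_IZR in Hd |- *; field; exact Hd.
Qed.

Lemma fourier_projE m (a : Ainf al) : fourier_proj al m a = fourier m (sval al a).
Proof. reflexivity. Qed.

Lemma pi0E (a : Ainf al) : pi0 al a = fourier 0 (sval al a).
Proof.
unfold pi0, fourier; f_equal; apply (RInt_ext (V := realify A)); intros t _.
rewrite Rmult_0_l Ropp_0 cis_0 cs_scal_1; reflexivity.
Qed.

End Fourier.

(** * Injectivity of the Fourier transform *)

(** This is [sin (t / 2) ^ 2]. Its maximum 1 sits at [PI], inside the interval of integration and
    not at its ends. *)
Definition bump (t : R) : R := (1 - cos t) / 2.

Lemma bump_bound t : 0 <= bump t <= 1.
Proof. unfold bump; generalize (COS_bound t); lra. Qed.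

Lemma is_derive_bump t : is_derive bump t (sin t / 2).
Proof. unfold bump; auto_derive; [exact I|]; field. Qed.

(** The integral of this derivative over a period vanishes, which relates the masses of [bump ^ n]
    and [bump ^ S n]. The identity [sin^2 = 4 bump (1 - bump)] keeps the derivative a polynomial in
    [bump]. *)
Lemma is_derive_sin_bump_pow n t :
  is_derive (fun t => sin t * bump t ^ n) t
    ((2 * INR n + 1) * bump t ^ n - (2 * INR n + 2) * bump t ^ S n).
Proof.
induction n as [|n IH].
- apply (is_derive_ext sin); [intros s; simpl; ring|].
  replace (_ - _) with (cos t) by (unfold bump; simpl; field); apply is_derive_sin.
- apply (is_derive_ext (fun t => mult (sin t * bump t ^ n) (bump t))).
  { intros s; change (sin s * bump s ^ n * bump s = sin s * bump s ^ S n); simpl; ring. }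
  assert (H := is_derive_mult _ _ t _ _ IH (is_derive_bump t) Rmult_comm).
  replace (_ - _) with (plus
    (mult ((2 * INR n + 1) * bump t ^ n - (2 * INR n + 2) * bump t ^ S n) (bump t))
    (mult (sin t * bump t ^ n) (sin t / 2))); [exact H|].
  change (((2 * INR n + 1) * bump t ^ n - (2 * INR n + 2) * bump t ^ S n) * bump t
    + (sin t * bump t ^ n) * (sin t / 2) =
    (2 * INR (S n) + 1) * bump t ^ S n - (2 * INR (S n) + 2) * bump t ^ S (S n)).
  assert (E : sin t * sin t = 4 * bump t * (1 - bump t)).
  { generalize (sin2_cos2 t); unfold Rsqr, bump; lra. }
  replace (sin t * bump t ^ n * (sin t / 2)) with
    (sin t * sin t * bump t ^ n / 2) by field.
  rewrite E S_INR; simpl; field.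
Qed.

(** The Wallis integrals, [2 PI] times the central binomial coefficient of [2n] over [4^n]. Only the
    ratio of consecutive values is used. *)
Fixpoint bump_mass (n : nat) : R :=
  match n with
  | O => 2 * PI
  | S n => (2 * INR n + 1) / (2 * INR n + 2) * bump_mass n
  end.

Lemma bump_mass_pos n : 0 < bump_mass n.
Proof.
induction n as [|n IH]; simpl; [generalize PI_RGT_0; lra|].
apply Rmult_lt_0_compat; [|exact IH].
apply Rdiv_lt_0_compat; generalize (pos_INR n); lra.
Qed.

Lemma continuous_bump_pow n t : continuous (fun t => bump t ^ n) t.
Proof.
induction n as [|n IH]; simpl; [apply continuous_const|].
apply (continuous_mult bump); [|exact IH].
apply (ex_derive_continuous (V := R_NormedModule) bump t); eexists; apply is_derive_bump.
Qed.

Lemma is_RInt_bump_pow n : is_RInt (fun t => bump t ^ n) 0 (2 * PI) (bump_mass n).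
Proof.
induction n as [|n IH].
- replace (bump_mass 0) with (scal (2 * PI - 0) 1)
    by (change ((2 * PI - 0) * 1 = 2 * PI); ring).
  apply (is_RInt_const (V := R_NormedModule)).
- assert (Hn := pos_INR n).
  assert (H := is_RInt_derive (V := R_CompleteNormedModule)
    (fun t => sin t * bump t ^ n)
    (fun t => (2 * INR n + 1) * bump t ^ n - (2 * INR n + 2) * bump t ^ S n)
    0 (2 * PI) (fun t _ => is_derive_sin_bump_pow n t)
    ltac:(intros t _; apply (continuous_minus (V := R_NormedModule));
      apply (continuous_scal_r (V := R_NormedModule)); apply continuous_bump_pow)).
  rewrite sin_2PI sin_0 !Rmult_0_l in H.
  assert (H1 := is_RInt_scal (V := R_NormedModule) _ _ _ (/ (2 * INR n + 2)) _
    (is_RInt_minus (V := R_NormedModule) _ _ _ _ _ _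
      (is_RInt_scal (V := R_NormedModule) _ _ _ (2 * INR n + 1) _ IH) H)).
  replace (bump_mass (S n)) with (scal (/ (2 * INR n + 2))
    (minus (scal (2 * INR n + 1) (bump_mass n)) (minus 0 0))).
  + eapply is_RInt_ext; [|exact H1]; intros t _.
    change (/ (2 * INR n + 2) * ((2 * INR n + 1) * bump t ^ n
      + - ((2 * INR n + 1) * bump t ^ n - (2 * INR n + 2) * bump t ^ S n)) = bump t ^ S n).
    field; lra.
  + change (/ (2 * INR n + 2) * ((2 * INR n + 1) * bump_mass n + - (0 + - 0))
      = (2 * INR n + 1) / (2 * INR n + 2) * bump_mass n).
    field; lra.
Qed.

(** From [v - v^3 / 6 >= v / 3] on [[0, 2]] follows [1 - cos u = 2 sin (u / 2) ^ 2 >= u^2 / 18] for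
    [u = |t - PI|], and [1 - bump t] is half of [1 - cos u]. *)
Lemma bump_peak t : 0 <= t <= 2 * PI -> (t - PI) ^ 2 <= 36 * (1 - bump t).
Proof.
intros Ht; assert (HP := PI_RGT_0); assert (H4 := PI_4).
assert (Hs : forall v, 0 <= v -> v <= 2 -> v <= PI -> v / 3 <= sin v).
{ intros v Hv Hv2 HvP; assert (H := proj1 (sin_bound v 0 Hv HvP)).
  unfold sin_approx, sin_term in H; simpl in H.
  eapply Rle_trans; [|exact H].
  replace (_ + _) with (v - v * (v * v) / 6) by field.
  assert (v * v <= 2 * 2) by (apply Rmult_le_compat; lra).
  assert (v * (v * v) <= v * 4) by (apply Rmult_le_compat_l; lra); lra. }
assert (Hc : forall u, 0 <= u <= PI -> u * u <= 18 * (1 - cos u)).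
{ intros u Hu; specialize (Hs (u / 2) ltac:(lra) ltac:(lra) ltac:(lra)).
  assert (E : cos u = 1 - 2 * sin (u / 2) * sin (u / 2)).
  { rewrite -cos_2a_sin; f_equal; field. }
  rewrite E.
  assert (u / 2 / 3 * (u / 2 / 3) <= sin (u / 2) * sin (u / 2))
    by (apply Rmult_le_compat; lra).
  lra. }
assert (E : forall u, u = t - PI \/ u = PI - t -> cos u = - cos t).
{ intros u [-> | ->].
  - rewrite -(cos_neg (t - PI)) Ropp_minus_distr.
    rewrite cos_minus cos_PI sin_PI; ring.
  - rewrite cos_minus cos_PI sin_PI; ring. }
unfold bump; destruct (Rle_dec PI t) as [H|H].
- specialize (Hc (t - PI) ltac:(lra)); rewrite (E (t - PI) (or_introl eq_refl)) in Hc.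
  simpl; lra.
- specialize (Hc (PI - t) ltac:(lra)); rewrite (E (PI - t) (or_intror eq_refl)) in Hc.
  simpl; lra.
Qed.

Section Uniqueness.
Context {A : CStarAlgebra} (al : CircleAction A).
Implicit Types (a b x y : A).

(** Since [bump t = 1 / 2 - (e^(it) + e^(-it)) / 4], one more factor of [bump] mixes the weights
    [m - 1], [m], [m + 1]; the induction on [n] therefore carries all weights at once. *)
Lemma bump_fourier_zero a : (forall m, fourier al m a = zero) ->
  forall n m, is_RInt (V := realify A)
    (fun t => scal (cis (- (IZR m * t))) (scal (RtoC (bump t ^ n)) (al t a)))
    0 (2 * PI) zero.
Proof.
intros Ha n; induction n as [|n IH]; intros m.
- eapply is_RInt_ext; [|eapply eq_ind; [apply RInt_correct, (fourier_integrable al m a)|]].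
  + intros t _; simpl pow; rewrite cs_scal_1; reflexivity.
  + assert (H := Ha m); unfold fourier in H.
    apply (f_equal (scal (RtoC (2 * PI)))) in H.
    rewrite cs_scal_assoc -RtoC_mult Rinv_r in H; [|generalize PI_RGT_0; lra].
    rewrite cs_scal_1 cs_scal_zero in H; exact H.
- assert (H := is_RInt_plus (V := realify A) _ _ _ _ _ _
    (is_RInt_scal (V := realify A) _ _ _ (1 / 2) _ (IH m))
    (is_RInt_scal (V := realify A) _ _ _ (- / 4) _
      (is_RInt_plus (V := realify A) _ _ _ _ _ _ (IH (m - 1)%Z) (IH (m + 1)%Z)))).
  eapply is_RInt_ext; [|eapply eq_ind; [exact H|]].
  + intros t _.
    change (plus (scal (RtoC (1 / 2))
          (scal (cis (- (IZR m * t))) (scal (RtoC (bump t ^ n)) (al t a))))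
        (scal (RtoC (- / 4)) (plus
          (scal (cis (- (IZR (m - 1) * t))) (scal (RtoC (bump t ^ n)) (al t a)))
          (scal (cis (- (IZR (m + 1) * t))) (scal (RtoC (bump t ^ n)) (al t a))))) =
      scal (cis (- (IZR m * t))) (scal (RtoC (bump t ^ S n)) (al t a))).
    rewrite -cs_scal_distr_r !cs_scal_assoc -cs_scal_distr_r; f_equal.
    replace (- (IZR (m - 1) * t)) with (- (IZR m * t) + t)
      by (rewrite minus_IZR; ring).
    replace (- (IZR (m + 1) * t)) with (- (IZR m * t) + - t)
      by (rewrite plus_IZR; ring).
    rewrite !cis_plus -tech_pow_Rmult; set (B := bump t ^ n); unfold bump.
    generalize (cis (- (IZR m * t))); intros [p q]; rewrite /cis cos_neg sin_neg.
    apply injective_projections; simpl; field.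
  + change (plus (scal (RtoC (1 / 2)) (zero : A))
      (scal (RtoC (- / 4)) (plus (zero : A) zero)) = zero).
    rewrite plus_zero_r !cs_scal_zero; apply plus_zero_r.
Qed.

(* The mass of [bump ^ n] concentrates at [t = PI], so the vanishing integral
   of [bump t ^ n * al t a] is close to [bump_mass n * al PI a]. *)
Theorem fourier_injective a : (forall m, fourier al m a = zero) -> a = zero.
Proof.
intros Ha; apply (norm_eq_zero (V := A)), Rle_antisym; [|apply cs_norm_ge_0].
change (norm a <= 0); apply le_epsilon; intros e He; rewrite Rplus_0_l.
assert (Hn0 := cs_norm_ge_0 a).
destruct (proj1 (filterlim_locally_ball_norm (U := realify A) _ _)
  (continuous_orbit al a PI) (mkposreal e He)) as [d Hd].
(* Chosen so that [K * (d^2 / 36) = 2 * norm a]: at distance at least [d] from [PI],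
   [K * (1 - bump t)] alone dominates the trivial bound, and a single estimate holds on the whole
   circle. *)
set (K := 72 * norm a / (d * d)).
assert (Hd0 := cond_pos d).
assert (HK : 0 <= K).
{ apply Rmult_le_pos; [lra|]; left; apply Rinv_0_lt_compat; nra. }
assert (Hb : forall t, 0 <= t <= 2 * PI ->
  norm (minus (al PI a) (al t a)) <= e + K * (1 - bump t)).
{ intros t Ht; assert (HB := bump_bound t).
  destruct (Rlt_dec (Rabs (t - PI)) d) as [Hlt|Hge].
  - specialize (Hd t Hlt); change (norm (minus (al t a) (al PI a)) < e) in Hd.
    rewrite norm_minus_sym; nra.
  - assert (Hq : d * d <= 36 * (1 - bump t)).
    { apply Rle_trans with ((t - PI) ^ 2); [|apply bump_peak, Ht].
      rewrite -pow2_abs; simpl; rewrite Rmult_1_r.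
      apply Rmult_le_compat; lra. }
    apply Rle_trans with (2 * norm a).
    + eapply Rle_trans; [apply cs_norm_triangle|].
      rewrite (norm_opp (V := A)) !norm_act; lra.
    + apply Rle_trans with (K * (d * d / 36)).
      * right; unfold K; field; lra.
      * apply Rle_trans with (K * (1 - bump t)); [|lra].
        apply Rmult_le_compat_l; lra. }
(* Integrate the estimate against [bump ^ n] and divide by its mass; the error is the relative loss
   of mass [1 - (2n + 1) / (2n + 2)] from [n] to [n + 1]. *)
assert (Hm : forall n, norm a <= e + K * / (2 * INR n + 2)).
{ intros n; assert (Hpn := pos_INR n); assert (Hp := bump_mass_pos n).
  assert (H1 := bump_fourier_zero a Ha n 0).
  assert (H2 : is_RInt (V := realify A)
    (fun t => scal (RtoC (bump t ^ n)) (al PI a)) 0 (2 * PI)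
    (scal (RtoC (bump_mass n)) (al PI a))).
  { rewrite -(is_RInt_unique _ _ _ _ (is_RInt_bump_pow n)).
    assert (HL := is_linear_scal_l (V := realify A) (al PI a)).
    assert (E := RInt_linear (U := R_CompleteNormedModule) (V := realify A) _
      (fun t => bump t ^ n) 0 (2 * PI) HL (continuous_bump_pow n)).
    eapply eq_ind; [|exact E]; apply (RInt_correct (V := realify A)).
    apply ex_RInt_continuous; intros t _.
    apply (continuous_linear (U := R_CompleteNormedModule) (V := realify A) _ _ _ HL).
    apply continuous_bump_pow. }
  assert (H3 := is_RInt_minus (V := realify A) _ _ _ _ _ _ H2 H1).
  assert (H4 := is_RInt_minus (V := R_NormedModule) _ _ _ _ _ _
    (is_RInt_scal (V := R_NormedModule) _ _ _ (e + K) _ (is_RInt_bump_pow n))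
    (is_RInt_scal (V := R_NormedModule) _ _ _ K _ (is_RInt_bump_pow (S n)))).
  assert (Hpt : forall t, 0 <= t <= 2 * PI ->
    norm (minus (scal (RtoC (bump t ^ n)) (al PI a))
       (scal (cis (- (IZR 0 * t))) (scal (RtoC (bump t ^ n)) (al t a)))) <=
      (e + K) * bump t ^ n + - (K * (bump t * bump t ^ n))).
  { intros t Ht; assert (HB := bump_bound t); assert (HBn := pow_le (bump t) n (proj1 HB)).
    rewrite Rmult_0_l Ropp_0 cis_0 cs_scal_1 -cs_scal_minus cs_norm_scal Cmod_R.
    rewrite Rabs_pos_eq; [|exact HBn].
    apply Rle_trans with (bump t ^ n * (e + K * (1 - bump t))); [|lra].
    apply Rmult_le_compat_l; [exact HBn|apply Hb, Ht]. }
  assert (H5 := norm_RInt_le (V := realify A) _ _ 0 (2 * PI) _ _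
    ltac:(generalize PI_RGT_0; lra) Hpt H3 H4).
  change (norm (minus (scal (RtoC (bump_mass n)) (al PI a)) (zero : A)) <=
    (e + K) * bump_mass n
    + - (K * ((2 * INR n + 1) / (2 * INR n + 2) * bump_mass n))) in H5.
  unfold minus in H5; rewrite opp_zero plus_zero_r cs_norm_scal Cmod_R norm_act in H5.
  rewrite Rabs_pos_eq in H5; [|lra].
  apply (Rmult_le_reg_l (bump_mass n)); [exact Hp|].
  eapply Rle_trans; [exact H5|]; right; field; lra. }
apply le_epsilon; intros e' He'.
destruct (nfloor_ex (K / e')) as [n [_ Hn]].
{ apply Rdiv_le_0_compat; assumption. }
eapply Rle_trans; [apply (Hm n)|]; apply Rplus_le_compat_l.
assert (Hpn := pos_INR n).
apply (Rmult_le_reg_r (2 * INR n + 2)); [lra|].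
rewrite Rmult_assoc Rinv_l ?Rmult_1_r; [|lra].
apply (Rmult_lt_compat_r e') in Hn; [|exact He'].
unfold Rdiv in Hn; rewrite Rmult_assoc Rinv_l ?Rmult_1_r in Hn; [|lra]; nra.
Qed.

End Uniqueness.

(** * Smooth vectors and the generator *)

Section Smooth.
Context {A : CStarAlgebra} (al : CircleAction A).

Definition orbit (x : A) : R -> realify A := fun s => al s x.

Lemma is_derive_orbit_shift (x : A) (l : A) t :
  is_derive (orbit x) 0 (l : realify A) -> is_derive (orbit x) t (al t l : realify A).
Proof.
intros H.
assert (H1 : is_derive (fun s => al t (al (s - t) x) : realify A) t (al t l : realify A)).
{ apply (is_derive_linear (U := realify A) (V := realify A) (al t)
    (fun s => orbit x (s - t)) t l); [apply real_linear_act|].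
  replace (l : realify A) with (scal 1 (l : realify A)) by exact (scal_one (V := realify A) l).
  apply (is_derive_comp (orbit x) (fun s => s - t)).
  - replace (t - t) with 0 by ring; exact H.
  - auto_derive; [exact I|ring]. }
eapply is_derive_ext; [|exact H1].
intros s; unfold orbit; simpl; rewrite -act_add; f_equal; ring.
Qed.

(** The group law makes the derivative of an orbit the orbit of its value at 0. By uniqueness every
    derivative provided by [Cn (S n)] is that same orbit, so the value at 0 is smooth. *)
Lemma smooth_derivative_exists (x : A) : is_smooth al x ->
  exists y, is_smooth al y /\ forall t, is_derive (orbit x) t (al t y : realify A).
Proof.
intros Hx; destruct (Hx 1%nat) as [f' [Hf' _]].
assert (Hd : forall t, is_derive (orbit x) t (al t (f' 0) : realify A))
  by (intros t; apply is_derive_orbit_shift, Hf').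
exists (f' 0); split; [|exact Hd].
intros n; destruct (Hx (S n)) as [g [Hg Cg]].
apply (Cn_ext n g); [|exact Cg].
intros t; exact (derive_unique (orbit x) t _ _ (Hg t) (Hd t)).
Qed.

Lemma vderive_orbit_smooth (x : A) : is_smooth al x ->
  is_smooth al (vderive (orbit x) 0).
Proof.
intros Hx; destruct (smooth_derivative_exists x Hx) as [y [Hy Hd]].
rewrite (vderive_eq _ 0 _ (Hd 0)) act_zero; exact Hy.
Qed.

(** The infinitesimal generator [D] of the action. Carrying the smoothness proof makes it an
    endomap, so it can be iterated. *)
Definition generator (a : Ainf al) : Ainf al :=
  exist _ (vderive (orbit (sval al a)) 0) (vderive_orbit_smooth _ (proj2_sig a)).

Lemma is_derive_orbit (a : Ainf al) t :
  is_derive (orbit (sval al a)) t (al t (sval al (generator a)) : realify A).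
Proof.
destruct (smooth_derivative_exists _ (proj2_sig a)) as [y [Hy Hd]].
simpl; rewrite (vderive_eq _ 0 _ (Hd 0)) act_zero; apply Hd.
Qed.

Lemma generator_unique (a b : Ainf al) :
  is_derive (orbit (sval al a)) 0 (sval al b : realify A) -> generator a = b.
Proof.
intros H; apply Ainf_ext.
assert (H1 := is_derive_orbit a 0); rewrite act_zero in H1.
exact (derive_unique _ 0 _ _ H1 H).
Qed.

Definition generator_iter (j : nat) (a : Ainf al) : Ainf al := Nat.iter j generator a.

Lemma generator_iter_succ j a :
  generator_iter j (generator a) = generator_iter (S j) a.
Proof. symmetry; apply Nat.iter_succ_r. Qed.

Lemma vderive_n_orbit j (a : Ainf al) :
  vderive_n (orbit (sval al a)) j = orbit (sval al (generator_iter j a)).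
Proof.
induction j as [|j IH]; [reflexivity|].
unfold vderive_n in *; simpl; rewrite IH; apply functional_extensionality; intros t.
exact (vderive_eq _ t _ (is_derive_orbit (generator_iter j a) t)).
Qed.

Lemma orbit_sup_eq j (a : Ainf al) :
  orbit_sup al j a = norm (sval al (generator_iter j a)).
Proof.
unfold orbit_sup.
rewrite (is_lub_Rbar_unique _ (Finite (norm (sval al (generator_iter j a))))); [reflexivity|].
assert (E : forall t, norm (vderive_n (orbit (sval al a)) j t) =
  norm (sval al (generator_iter j a))).
{ intros t; rewrite vderive_n_orbit; apply norm_act. }
split.
- intros r [t [_ ->]]; rewrite E; apply Rle_refl.
- intros M HM; rewrite -(E 0); apply HM; exists 0; split; [|reflexivity].
  generalize PI_RGT_0; lra.
Qed.

Lemma seminorm_ge j k (a : Ainf al) : (j <= k)%nat ->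
  norm (sval al (generator_iter j a)) <= Ainf_seminorm al k a.
Proof.
intros Hj; induction Hj as [|k Hj IH].
- destruct j as [|j]; simpl Ainf_seminorm; rewrite orbit_sup_eq;
    [apply Rle_refl|apply Rmax_r].
- eapply Rle_trans; [apply IH|apply Rmax_l].
Qed.

Lemma seminorm_le k (a : Ainf al) M :
  (forall j, (j <= k)%nat -> norm (sval al (generator_iter j a)) <= M) ->
  Ainf_seminorm al k a <= M.
Proof.
intros H; induction k as [|k IH]; simpl Ainf_seminorm.
- rewrite orbit_sup_eq; apply H; lia.
- apply Rmax_lub; [apply IH; auto|rewrite orbit_sup_eq; apply H; lia].
Qed.

Lemma norm_le_seminorm k (a : Ainf al) : norm (sval al a) <= Ainf_seminorm al k a.
Proof. apply (seminorm_ge 0); lia. Qed.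

Lemma seminorm_ge_0 k (a : Ainf al) : 0 <= Ainf_seminorm al k a.
Proof. exact (Rle_trans _ _ _ (cs_norm_ge_0 (sval al a)) (norm_le_seminorm k a)). Qed.

Lemma seminorm_mono j k (a : Ainf al) : (j <= k)%nat ->
  Ainf_seminorm al j a <= Ainf_seminorm al k a.
Proof. intros H; apply seminorm_le; intros i Hi; apply seminorm_ge; lia. Qed.

Lemma seminorm_generator k (a : Ainf al) :
  Ainf_seminorm al k (generator a) <= Ainf_seminorm al (S k) a.
Proof.
apply seminorm_le; intros j Hj; rewrite generator_iter_succ; apply seminorm_ge; lia.
Qed.

Lemma seminorm_succ_le k (a : Ainf al) M : norm (sval al a) <= M ->
  Ainf_seminorm al k (generator a) <= M -> Ainf_seminorm al (S k) a <= M.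
Proof.
intros H0 H; apply seminorm_le; intros [|j] Hj; [exact H0|].
rewrite -generator_iter_succ; eapply Rle_trans; [apply (seminorm_ge j k); lia|exact H].
Qed.

Lemma generator_plus (a b : Ainf al) :
  generator (plus a b) = plus (generator a) (generator b).
Proof.
apply generator_unique.
apply (is_derive_ext (fun s => plus (orbit (sval al a) s) (orbit (sval al b) s))).
{ intros s; symmetry; apply (act_plus al s). }
assert (Ha := is_derive_orbit a 0); assert (Hb := is_derive_orbit b 0).
rewrite act_zero in Ha; rewrite act_zero in Hb.
exact (is_derive_plus (V := realify A) _ _ _ _ _ Ha Hb).
Qed.

(** Such operators preserve smoothness and commute with the generator. A norm bound on [A] thus
    passes to every Fréchet seminorm with the same constant and no loss of order. *)
Record equivariant (L : A -> A) : Prop := {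
  equivariant_linear : real_linear L;
  equivariant_act : forall t x, L (al t x) = al t (L x)
}.

Lemma equivariant_smooth L (x : A) : equivariant L -> is_smooth al x -> is_smooth al (L x).
Proof.
intros HL Hx n.
apply (Cn_ext n (fun s => L (orbit x s) : realify A)).
{ intros s; apply (equivariant_act L HL). }
apply (Cn_linear (U := realify A) (V := realify A)); [apply equivariant_linear, HL|apply Hx].
Qed.

Definition lift L (HL : equivariant L) (a : Ainf al) : Ainf al :=
  exist _ (L (sval al a)) (equivariant_smooth L _ HL (proj2_sig a)).

Lemma generator_lift L (HL : equivariant L) a :
  generator (lift L HL a) = lift L HL (generator a).
Proof.
apply generator_unique.
apply (is_derive_ext (fun s => L (orbit (sval al a) s) : realify A)).
{ intros s; apply (equivariant_act L HL). }
assert (Ha := is_derive_orbit a 0); rewrite act_zero in Ha.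
apply (is_derive_linear (U := realify A) (V := realify A)); [apply equivariant_linear, HL|].
exact Ha.
Qed.

Lemma generator_iter_lift L (HL : equivariant L) j a :
  generator_iter j (lift L HL a) = lift L HL (generator_iter j a).
Proof.
induction j as [|j IH]; [reflexivity|]; simpl; rewrite IH generator_lift; reflexivity.
Qed.

Lemma seminorm_lift L (HL : equivariant L) M k a : 0 <= M ->
  (forall x, norm (L x) <= M * norm x) ->
  Ainf_seminorm al k (lift L HL a) <= M * Ainf_seminorm al k a.
Proof.
intros HM H; apply seminorm_le; intros j Hj; rewrite generator_iter_lift.
eapply Rle_trans; [apply H|]; apply Rmult_le_compat_l; [exact HM|].
apply seminorm_ge, Hj.
Qed.

Lemma equivariant_scal (k : C) : equivariant (scal k).
Proof.
split; [apply real_linear_scal|intros; symmetry; apply act_scal].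
Qed.

Lemma lift_scal (k : C) (a : Ainf al) : lift _ (equivariant_scal k) a = scal k a.
Proof. apply Ainf_ext; reflexivity. Qed.

Lemma generator_iter_plus j (a b : Ainf al) :
  generator_iter j (plus a b) = plus (generator_iter j a) (generator_iter j b).
Proof.
induction j as [|j IH]; [reflexivity|]; simpl; rewrite IH; apply generator_plus.
Qed.

Lemma generator_iter_scal j (k : C) (a : Ainf al) :
  generator_iter j (scal k a) = scal k (generator_iter j a).
Proof. rewrite -lift_scal generator_iter_lift; apply lift_scal. Qed.

Lemma seminorm_Ainf k : seminorm (V := Ainf_ModuleSpace al) (Ainf_seminorm al k).
Proof.
assert (Hs : forall (c : C) a,
  Ainf_seminorm al k (scal c a) <= Cmod c * Ainf_seminorm al k a).
{ intros c a; rewrite -lift_scal; apply seminorm_lift; [apply Cmod_ge_0|].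
  intros x; right; apply cs_norm_scal. }
split; [apply seminorm_ge_0|split].
- intros a b; apply seminorm_le; intros j Hj; rewrite generator_iter_plus.
  eapply Rle_trans; [apply cs_norm_triangle|].
  apply Rplus_le_compat; apply seminorm_ge, Hj.
- intros c a; apply Rle_antisym; [apply Hs|].
  destruct (Ceq_dec c 0) as [->|Hc].
  + rewrite Cmod_0 Rmult_0_l; apply seminorm_ge_0.
  + assert (E : a = scal (/ c)%C (scal c a)).
    { apply Ainf_ext.
      change (sval al a = scal (/ c)%C (scal c (sval al a))).
      rewrite cs_scal_assoc (Cinv_l _ Hc) cs_scal_1; reflexivity. }
    assert (H := Hs (/ c)%C (scal c a)); rewrite -E (Cmod_inv _ Hc) in H.
    assert (Hp := proj1 (Cmod_gt_0 c) Hc).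
    apply (Rmult_le_compat_l (Cmod c)) in H; [|lra].
    rewrite -Rmult_assoc Rinv_r ?Rmult_1_l in H; lra.
Qed.

Definition Ainf_mul (a b : Ainf al) : Ainf al :=
  exist _ (cs_mul (sval al a) (sval al b))
    (smooth_mul al _ _ (proj2_sig a) (proj2_sig b)).

Lemma generator_mul (a b : Ainf al) : generator (Ainf_mul a b) =
  plus (Ainf_mul (generator a) b) (Ainf_mul a (generator b)).
Proof.
apply generator_unique.
apply (is_derive_ext
  (fun s => cs_mul (orbit (sval al a) s) (orbit (sval al b) s) : realify A)).
{ intros s; symmetry; apply (act_mul al s). }
assert (Ha := is_derive_orbit a 0); assert (Hb := is_derive_orbit b 0).
rewrite act_zero in Ha; rewrite act_zero in Hb.
assert (H := is_derive_bilinear (V := realify A) cs_mul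
  (cs_mul_plus_l A) (cs_mul_plus_r A)
  (fun k x y => cs_mul_scal_l A (RtoC k) x y)
  (fun k x y => cs_mul_scal_r A (RtoC k) x y)
  (cs_norm_mul A) _ _ 0 _ _ Ha Hb).
unfold orbit in H at 3 4; rewrite !act_zero in H; exact H.
Qed.

(** By the Leibniz rule the derivative of a product is a sum of two products, so each order doubles
    the constant. *)
Lemma seminorm_mul k (a b : Ainf al) : Ainf_seminorm al k (Ainf_mul a b) <=
  2 ^ k * (Ainf_seminorm al k a * Ainf_seminorm al k b).
Proof.
assert (H0 : forall k (a b : Ainf al), norm (sval al (Ainf_mul a b)) <=
  Ainf_seminorm al k a * Ainf_seminorm al k b).
{ intros i x y; eapply Rle_trans; [apply cs_norm_mul|].
  apply Rmult_le_compat; auto using cs_norm_ge_0, norm_le_seminorm. }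
revert a b; induction k as [|k IH]; intros a b.
- simpl pow; rewrite Rmult_1_l; apply seminorm_le; intros j Hj.
  replace j with 0%nat by lia; apply H0.
- assert (Hp : 1 <= 2 ^ k) by (apply pow_R1_Rle; lra).
  assert (Pa := seminorm_ge_0 (S k) a); assert (Pb := seminorm_ge_0 (S k) b).
  assert (P := Rmult_le_pos _ _ Pa Pb).
  apply seminorm_succ_le.
  + eapply Rle_trans; [apply (H0 (S k))|]; simpl pow; nra.
  + rewrite generator_mul.
    eapply Rle_trans; [apply (proj1 (proj2 (seminorm_Ainf k)))|].
    assert (Hk : forall x y, Ainf_seminorm al k x <= Ainf_seminorm al (S k) a ->
      Ainf_seminorm al k y <= Ainf_seminorm al (S k) b ->
      Ainf_seminorm al k (Ainf_mul x y) <=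
      2 ^ k * (Ainf_seminorm al (S k) a * Ainf_seminorm al (S k) b)).
    { intros x y Hx Hy; eapply Rle_trans; [apply IH|].
      apply Rmult_le_compat_l; [lra|].
      apply Rmult_le_compat; auto using seminorm_ge_0. }
    assert (H1 := Hk (generator a) b (seminorm_generator k a)
      (seminorm_mono k (S k) b ltac:(lia))).
    assert (H2 := Hk a (generator b) (seminorm_mono k (S k) a ltac:(lia))
      (seminorm_generator k b)).
    simpl pow; lra.
Qed.

Lemma Ainf_bracket_eq (a b : Ainf al) :
  Ainf_bracket al a b = minus (Ainf_mul a b) (Ainf_mul b a).
Proof. apply Ainf_ext; reflexivity. Qed.

Lemma seminorm_minus k (a b : Ainf al) :
  Ainf_seminorm al k (minus a b) <= Ainf_seminorm al k a + Ainf_seminorm al k b.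
Proof.
eapply Rle_trans; [apply (proj1 (proj2 (seminorm_Ainf k)))|].
apply Rplus_le_compat_l; rewrite -(scal_opp_one (V := Ainf_ModuleSpace al)).
right; etransitivity; [apply (proj2 (proj2 (seminorm_Ainf k)))|].
change (Cmod (- (1))%C * Ainf_seminorm al k b = Ainf_seminorm al k b).
rewrite Cmod_opp Cmod_1 Rmult_1_l; reflexivity.
Qed.

Lemma seminorm_bracket k (a b : Ainf al) : Ainf_seminorm al k (Ainf_bracket al a b) <=
  2 ^ S k * (Ainf_seminorm al k a * Ainf_seminorm al k b).
Proof.
rewrite Ainf_bracket_eq; eapply Rle_trans; [apply seminorm_minus|].
generalize (seminorm_mul k a b) (seminorm_mul k b a); simpl pow.
rewrite (Rmult_comm (Ainf_seminorm al k b)); lra.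
Qed.

End Smooth.

(** * The Hardy projection *)

Lemma plus_interchange {G : AbelianMonoid} (p q r s : G) :
  plus (plus p q) (plus r s) = plus (plus p r) (plus q s).
Proof.
rewrite -!plus_assoc; f_equal; rewrite !plus_assoc; f_equal; apply plus_comm.
Qed.

Section Hardy.
Context {A : CStarAlgebra} (al : CircleAction A).
Implicit Types (x y : A) (a b : Ainf al).

Lemma cs_limit_unique (u : nat -> A) x y :
  filterlim u eventually (locally x) -> filterlim u eventually (locally y) -> x = y.
Proof. exact (filterlim_locally_unique (F := eventually) u x y). Qed.

Lemma cs_limit_eventually_const (u : nat -> A) x y N :
  (forall n, (N <= n)%nat -> u n = y) -> filterlim u eventually (locally x) -> x = y.
Proof.
intros Hu Hx; apply (cs_limit_unique u x y Hx).
apply cs_filterlim_iff; intros e He; exists N; intros n Hn; rewrite (Hu n Hn).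
replace (minus y y) with (zero : A) by non_commutative_ring.
rewrite (norm_zero (V := A)); exact He.
Qed.

Lemma filterlim_real_linear (L : A -> A) (u : nat -> A) x :
  real_linear L -> filterlim u eventually (locally x) ->
  filterlim (fun n => L (u n)) eventually (locally (L x)).
Proof.
intros HL Hu; apply cs_filterlim_iff; intros e He.
destruct (real_linear_bound L HL) as [M [HM HLM]].
destruct (proj1 (cs_filterlim_iff u x) Hu (e / M)) as [N HN].
{ apply Rdiv_lt_0_compat; assumption. }
exists N; intros n Hn; rewrite -real_linear_minus; [|exact HL].
eapply Rle_lt_trans; [apply HLM|].
apply (Rmult_lt_reg_l (/ M)); [apply Rinv_0_lt_compat, HM|].
rewrite -Rmult_assoc Rinv_l ?Rmult_1_l; [|lra].
rewrite Rmult_comm; apply HN, Hn.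
Qed.

(* [smoothing x] is the sum over [m >= 1] of [- m^-2 P_m x]; since
   [P_m (D^2 a) = - m^2 P_m a], applying it to [D^2 a] recovers the part of [a]
   of positive weight. *)
Fixpoint smoothing_partial (n : nat) (x : A) : A :=
  match n with
  | O => zero
  | S n => plus (smoothing_partial n x)
      (scal (RtoC (- / INR (S n) ^ 2)) (fourier al (Z.of_nat (S n)) x))
  end.

Lemma smoothing_partial_succ n x : smoothing_partial (S n) x =
  plus (smoothing_partial n x)
    (scal (RtoC (- / INR (S n) ^ 2)) (fourier al (Z.of_nat (S n)) x)).
Proof. reflexivity. Qed.

(** Uses [1 / r^2 <= 2 / (r (r + 1)) = 2 / r - 2 / (r + 1)]. Summed from [r = 1], this also gives
    the operator bound 2. *)
Lemma smoothing_partial_step n x :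
  norm (minus (smoothing_partial (S n) x) (smoothing_partial n x)) <=
  2 * norm x * / INR (S n) - 2 * norm x * / INR (S (S n)).
Proof.
assert (E : forall y z : A, minus (plus y z) y = z) by (intros; non_commutative_ring).
rewrite smoothing_partial_succ E.
rewrite cs_norm_scal Cmod_R Rabs_Ropp.
assert (Hp : 1 <= INR (S n)) by (rewrite S_INR; generalize (pos_INR n); lra).
rewrite (S_INR (S n)); set (r := INR (S n)) in *.
rewrite Rabs_pos_eq; [|left; apply Rinv_0_lt_compat, pow_lt; lra].
assert (H := norm_fourier al (Z.of_nat (S n)) x); assert (H0 := cs_norm_ge_0 x).
apply Rle_trans with (/ r ^ 2 * norm x).
{ apply Rmult_le_compat_l; [left; apply Rinv_0_lt_compat, pow_lt; lra|exact H]. }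
replace (2 * norm x * / r - 2 * norm x * / (r + 1)) with
  (2 * / (r * (r + 1)) * norm x) by (field; lra).
apply Rmult_le_compat_r; [exact H0|].
apply (Rmult_le_reg_l (r * r * (r + 1))); [nra|].
replace (r * r * (r + 1) * / r ^ 2) with (r + 1) by (field; lra).
replace (r * r * (r + 1) * (2 * / (r * (r + 1)))) with (2 * r) by (field; lra).
lra.
Qed.

Lemma smoothing_partial_bound n x : norm (smoothing_partial n x) <= 2 * norm x.
Proof.
assert (H : norm (smoothing_partial n x) <= 2 * norm x - 2 * norm x * / INR (S n)).
{ induction n as [|n IH].
  - simpl; rewrite (norm_zero (V := A)) Rinv_1; lra.
  - assert (E : forall y z : A, y = plus (minus y z) z) by (intros; non_commutative_ring).
    rewrite (E (smoothing_partial (S n) x) (smoothing_partial n x)).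
    eapply Rle_trans; [apply cs_norm_triangle|].
    generalize (smoothing_partial_step n x); lra. }
assert (Hp : 0 < / INR (S n)) by (apply Rinv_0_lt_compat, lt_0_INR; lia).
generalize (cs_norm_ge_0 x); nra.
Qed.

Definition smoothing (x : A) : A :=
  iota (fun l : A => filterlim (fun n => smoothing_partial n x) eventually (locally l)).

Lemma smoothing_lim x :
  filterlim (fun n => smoothing_partial n x) eventually (locally (smoothing x)).
Proof.
unfold smoothing; apply (iota_correct (V := A)
  (fun l => filterlim (fun n => smoothing_partial n x) eventually (locally l))).
destruct (telescoping_converges (V := A) (fun n => smoothing_partial n x)
  (fun n => 2 * norm x * / INR (S n))) as [l Hl].
- intros n; apply smoothing_partial_step.
- replace (Finite 0) with (Rbar_mult (2 * norm x) 0) by (simpl; f_equal; ring).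
  apply is_lim_seq_scal_l.
  replace (Finite 0) with (Rbar_inv p_infty) by reflexivity.
  apply (is_lim_seq_inv (fun n => INR (S n)) p_infty);
    [apply (is_lim_seq_incr_1 INR), is_lim_seq_INR|discriminate].
- exists l; split; [exact Hl|]; intros l' Hl'; exact (cs_limit_unique _ _ _ Hl Hl').
Qed.

Lemma norm_smoothing x : norm (smoothing x) <= 2 * norm x.
Proof.
apply (norm_lim_le (V := A) (fun n => smoothing_partial n x)); [apply smoothing_lim|].
intros n; apply smoothing_partial_bound.
Qed.

Lemma smoothing_partial_plus n x y : smoothing_partial n (plus x y) =
  plus (smoothing_partial n x) (smoothing_partial n y).
Proof.
induction n as [|n IH]; [symmetry; apply plus_zero_r|].
rewrite !smoothing_partial_succ IH fourier_plus cs_scal_plus.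
apply (plus_interchange (G := NormedModule.AbelianMonoid _ A)).
Qed.

Lemma smoothing_partial_comm (L : A -> A) n x : real_linear L ->
  (forall (r : R) x, L (scal (RtoC r) x) = scal (RtoC r) (L x)) ->
  (forall m x, L (fourier al m x) = fourier al m (L x)) ->
  L (smoothing_partial n x) = smoothing_partial n (L x).
Proof.
intros HL Hs HF; induction n as [|n IH].
- apply real_linear_zero, HL.
- rewrite !smoothing_partial_succ (real_linear_plus L _ _ HL) IH Hs HF; reflexivity.
Qed.

Lemma smoothing_comm (L : A -> A) x : real_linear L ->
  (forall (r : R) x, L (scal (RtoC r) x) = scal (RtoC r) (L x)) ->
  (forall m x, L (fourier al m x) = fourier al m (L x)) ->
  L (smoothing x) = smoothing (L x).
Proof.
intros HL Hs HF.
apply (cs_limit_unique (fun n => L (smoothing_partial n x))).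
- apply filterlim_real_linear; [exact HL|apply smoothing_lim].
- eapply filterlim_ext; [|apply smoothing_lim].
  intros n; symmetry; apply smoothing_partial_comm; assumption.
Qed.

Lemma real_linear_smoothing : real_linear smoothing.
Proof.
apply (real_linear_intro _ 2); [| |apply norm_smoothing].
- intros x y; apply (cs_limit_unique (fun n => smoothing_partial n (plus x y)));
    [apply smoothing_lim|].
  apply (filterlim_ext (fun n => plus (smoothing_partial n x) (smoothing_partial n y))).
  { intros n; symmetry; apply smoothing_partial_plus. }
  apply cs_filterlim_plus; apply smoothing_lim.
- intros r x; symmetry; apply smoothing_comm.
  + apply real_linear_scal.
  + intros s y; rewrite !cs_scal_assoc Cmult_comm; reflexivity.
  + intros m y; symmetry; apply fourier_scal.
Qed.

Lemma smoothing_equivariant : equivariant al smoothing.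
Proof.
split; [apply real_linear_smoothing|]; intros t x; symmetry; apply smoothing_comm.
- apply real_linear_act.
- intros; apply act_scal.
- intros; apply act_fourier.
Qed.

Lemma fourier_equivariant m : equivariant al (fourier al m).
Proof. split; [apply real_linear_fourier|intros; symmetry; apply act_fourier]. Qed.

(** [smoothing x] is a norm limit of sums of vectors of positive weight, so a bounded [L] killing
    those kills it. Needed for single Fourier coefficients and for coefficients of products. *)
Lemma real_linear_smoothing_zero (L : A -> A) x : real_linear L ->
  (forall m (r : R) x, (0 < m)%Z -> L (scal (RtoC r) (fourier al m x)) = zero) ->
  L (smoothing x) = zero.
Proof.
intros HL H; apply (cs_limit_eventually_const (fun n => L (smoothing_partial n x)) _ _ 0).
- intros n _; induction n as [|n IH].
  + apply real_linear_zero, HL.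
  + rewrite smoothing_partial_succ (real_linear_plus L _ _ HL) IH H; [apply plus_zero_r|lia].
- apply filterlim_real_linear; [exact HL|apply smoothing_lim].
Qed.

Lemma fourier_smoothing_le0 m x : (m <= 0)%Z -> fourier al m (smoothing x) = zero.
Proof.
intros Hm; apply real_linear_smoothing_zero; [apply real_linear_fourier|].
intros k r y Hk; assert (Hmk : m <> k) by lia.
rewrite fourier_scal (fourier_of_other_weight al _ _ _ Hmk (has_weight_fourier al k y)).
apply cs_scal_zero.
Qed.

Lemma fourier_smoothing_gt0 m x : (0 < m)%Z ->
  fourier al m (smoothing x) = scal (RtoC (- / IZR m ^ 2)) (fourier al m x).
Proof.
intros Hm.
(* The coefficient appears at index [m] and stays constant from there on, so its limit is
   attained. *)
assert (Hw : forall n, fourier al m (smoothing_partial n x) =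
  if (m <=? Z.of_nat n)%Z then scal (RtoC (- / IZR m ^ 2)) (fourier al m x) else zero).
{ induction n as [|n IH].
  - rewrite (proj2 (Z.leb_gt _ _)); [|lia]; apply real_linear_zero, real_linear_fourier.
  - rewrite smoothing_partial_succ fourier_plus IH fourier_scal.
    destruct (Z.eq_dec m (Z.of_nat (S n))) as [E|E].
    + rewrite -E (fourier_of_weight al m _ (has_weight_fourier al m x)).
      rewrite (proj2 (Z.leb_gt _ _)); [|lia]; rewrite Z.leb_refl.
      rewrite (INR_IZR_INZ (S n)) -E; apply plus_zero_l.
    + rewrite (fourier_of_other_weight al _ _ _ E (has_weight_fourier al _ x)).
      rewrite cs_scal_zero.
      replace (m <=? Z.of_nat (S n))%Z with (m <=? Z.of_nat n)%Z; [apply plus_zero_r|].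
      destruct (Z.leb_spec m (Z.of_nat n)), (Z.leb_spec m (Z.of_nat (S n)));
        first [reflexivity|lia]. }
apply (cs_limit_eventually_const (fun n => fourier al m (smoothing_partial n x)) _ _
  (Z.to_nat m)).
- intros n Hn; rewrite Hw (proj2 (Z.leb_le _ _)); [reflexivity|lia].
- apply filterlim_real_linear; [apply real_linear_fourier|apply smoothing_lim].
Qed.

(** Two computations of the derivative at 0 of [s -> P_m (al s a)]: through the bounded operator
    [P_m], and through [e^(ims) P_m a]. *)
Lemma fourier_generator m a : fourier al m (sval al (generator al a)) =
  scal (Cmult (RtoC (IZR m)) Ci) (fourier al m (sval al a)).
Proof.
set (z := fourier al m (sval al a)).
assert (H : is_derive (fun s => fourier al m (orbit al (sval al a) s) : realify A) 0
  (fourier al m (sval al (generator al a)) : realify A)).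
{ apply (is_derive_linear (U := realify A) (V := realify A));
    [apply real_linear_fourier|].
  assert (Ha := is_derive_orbit al a 0); rewrite act_zero in Ha; exact Ha. }
refine (derive_unique (V := realify A) _ 0 _ _ H _).
apply (is_derive_ext (fun s =>
  plus (scal (cos (IZR m * s)) (z : realify A))
    (scal (sin (IZR m * s)) (scal Ci z : realify A)))).
{ intros s; symmetry; etransitivity; [|exact (cis_scal (IZR m * s) z)].
  unfold orbit; rewrite -act_fourier; apply has_weight_fourier. }
assert (Hz : scal (Cmult (RtoC (IZR m)) Ci) z =
  plus (scal (RtoC 0) z) (scal (RtoC (IZR m)) (scal Ci z))).
{ rewrite cs_scal_assoc -cs_scal_distr_r; f_equal.
  apply injective_projections; simpl; ring. }
rewrite Hz.
apply (is_derive_plus (V := realify A)).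
- apply (is_derive_scal_l (V := realify A) (fun s => cos (IZR m * s)) 0 0 z).
  auto_derive; [exact I|]; rewrite Rmult_0_r sin_0; ring.
- apply (is_derive_scal_l (V := realify A) (fun s => sin (IZR m * s)) 0 (IZR m)
    (scal Ci z)).
  auto_derive; [exact I|]; rewrite Rmult_0_r cos_0; ring.
Qed.

Definition positive_part (a : Ainf al) : Ainf al :=
  lift al _ smoothing_equivariant (generator al (generator al a)).

Definition weight0_part (a : Ainf al) : Ainf al := lift al _ (fourier_equivariant 0) a.

Lemma fourier_positive_part m a : fourier al m (sval al (positive_part a)) =
  if (0 <? m)%Z then fourier al m (sval al a) else zero.
Proof.
destruct (Z.ltb_spec 0 m) as [Hm|Hm].
- etransitivity; [apply fourier_smoothing_gt0, Hm|].
  rewrite !fourier_generator; move: (fourier al m (sval al a)) => z.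
  rewrite !cs_scal_assoc -[RHS]cs_scal_1; f_equal.
  assert (Hm0 : IZR m <> 0) by (apply not_0_IZR; lia).
  apply injective_projections; simpl; field; exact Hm0.
- apply fourier_smoothing_le0, Hm.
Qed.

Lemma fourier_weight0_part m a : fourier al m (sval al (weight0_part a)) =
  if (m =? 0)%Z then fourier al 0 (sval al a) else zero.
Proof.
destruct (Z.eqb_spec m 0) as [->|Hm].
- apply fourier_of_weight, has_weight_fourier.
- apply (fourier_of_other_weight al m 0 _ Hm), has_weight_fourier.
Qed.

(* The factor [/ 2] makes the weight-zero parts of [hardy a] and [hardy a - a]
   opposite, as [p2] requires. *)
Definition hardy (a : Ainf al) : Ainf al :=
  plus (positive_part a) (scal (RtoC (/ 2)) (weight0_part a)).

Lemma lift_plus L (HL : equivariant al L) a b :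
  lift al L HL (plus a b) = plus (lift al L HL a) (lift al L HL b).
Proof. apply Ainf_ext, (real_linear_plus L), equivariant_linear with al, HL. Qed.

Lemma hardy_plus a b : hardy (plus a b) = plus (hardy a) (hardy b).
Proof.
unfold hardy, positive_part, weight0_part; rewrite !generator_plus !lift_plus.
rewrite (scal_distr_l (V := Ainf_ModuleSpace al)).
apply (plus_interchange (G := Ainf_AbelianGroup al)).
Qed.

Lemma hardy_minus a b : hardy (minus a b) = minus (hardy a) (hardy b).
Proof.
assert (E : plus (hardy (minus a b)) (hardy b) = hardy a).
{ rewrite -hardy_plus; f_equal; unfold minus.
  rewrite -(plus_assoc (G := Ainf_AbelianGroup al)) plus_opp_l; apply plus_zero_r. }
rewrite -E; unfold minus.
rewrite -(plus_assoc (G := Ainf_AbelianGroup al)) plus_opp_r; symmetry; apply plus_zero_r.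
Qed.

(** The second derivative in [positive_part] costs the two orders. The constant comes from 2 for
    [smoothing] plus 1/2 for the weight-zero part. *)
Lemma seminorm_hardy k a : Ainf_seminorm al k (hardy a) <= 3 * Ainf_seminorm al (S (S k)) a.
Proof.
assert (H1 : Ainf_seminorm al k (positive_part a) <= 2 * Ainf_seminorm al (S (S k)) a).
{ eapply Rle_trans; [apply (seminorm_lift al _ _ 2); [lra|apply norm_smoothing]|].
  apply Rmult_le_compat_l; [lra|].
  eapply Rle_trans; [apply seminorm_generator|apply seminorm_generator]. }
assert (H2 : Ainf_seminorm al k (weight0_part a) <= Ainf_seminorm al (S (S k)) a).
{ apply Rle_trans with (1 * Ainf_seminorm al k a).
  - apply seminorm_lift; [lra|]; intros x; rewrite Rmult_1_l; apply norm_fourier.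
  - rewrite Rmult_1_l; apply seminorm_mono; lia. }
destruct (seminorm_Ainf al k) as [_ [Hp Hs]].
eapply Rle_trans; [apply Hp|]; rewrite Hs Cmod_R Rabs_pos_eq; [|lra].
generalize (seminorm_ge_0 al k (weight0_part a)); lra.
Qed.

Lemma fourier_hardy m a : fourier al m (sval al (hardy a)) =
  if (0 <? m)%Z then fourier al m (sval al a)
  else if (m =? 0)%Z then scal (RtoC (/ 2)) (fourier al 0 (sval al a)) else zero.
Proof.
etransitivity; [apply (fourier_plus al m)|].
rewrite fourier_positive_part.
etransitivity; [apply f_equal, (fourier_scal al m)|].
rewrite fourier_weight0_part.
destruct (Z.ltb_spec 0 m), (Z.eqb_spec m 0); try lia; rewrite ?cs_scal_zero.
- apply plus_zero_r.
- apply plus_zero_l.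
- apply plus_zero_l.
Qed.

End Hardy.

(** * Completeness, products and states *)

Section Completeness.
Context {A : CStarAlgebra} (al : CircleAction A).
Implicit Types (x y : A) (a b : Ainf al).

Lemma orbit_integrable x c d : ex_RInt (orbit al x) c d.
Proof.
apply ex_RInt_continuous; intros t _; apply continuous_orbit.
Qed.

Lemma real_linear_orbit_integral t :
  real_linear (fun x => RInt (orbit al x) 0 t : A).
Proof.
apply (real_linear_intro _ (Rabs t)).
- intros x y; etransitivity;
    [|apply (RInt_plus (V := realify A)); apply orbit_integrable].
  apply (RInt_ext (V := realify A)); intros s _; apply act_plus.
- intros r x; etransitivity;
    [|apply (RInt_scal (V := realify A)); apply orbit_integrable].
  apply (RInt_ext (V := realify A)); intros s _; apply act_scal.
- intros x.
  assert (H := norm_RInt_le_const_abs (V := realify A) (orbit al x) 0 t _ (norm x)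
    (fun s _ => Req_le _ _ (norm_act al s x)) (RInt_correct _ _ _ (orbit_integrable x 0 t))).
  rewrite Rminus_0_r in H; exact H.
Qed.

(* The generator is closed: pass to the limit in
   [al t v - v = \int_0^t al s w ds]. *)
Lemma is_derive_orbit_limit (v w : nat -> A) x y :
  (forall n t, is_derive (orbit al (v n)) t (al t (w n) : realify A)) ->
  filterlim v eventually (locally x) -> filterlim w eventually (locally y) ->
  forall t, is_derive (orbit al x) t (al t y : realify A).
Proof.
intros Hd Hv Hw.
assert (E : forall t, minus (al t x) x = RInt (orbit al y) 0 t).
{ intros t; apply (cs_limit_unique (fun n => minus (al t (v n)) (v n))).
  - apply (filterlim_real_linear (fun x => minus (al t x) x)); [|exact Hv].
    apply (real_linear_intro _ 2).
    + intros a b; rewrite act_plus; non_commutative_ring.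
    + intros r a; rewrite act_scal cs_scal_minus; reflexivity.
    + intros a; eapply Rle_trans; [apply cs_norm_triangle|].
      rewrite (norm_opp (V := A)) norm_act; lra.
  - eapply filterlim_ext;
      [|apply (filterlim_real_linear _ w y (real_linear_orbit_integral t) Hw)].
    intros n; apply (is_RInt_unique (V := realify A)).
    rewrite -{2}(act_zero A al (v n)).
    apply (is_RInt_derive (orbit al (v n)) (orbit al (w n)));
      intros s _; [apply Hd|apply continuous_orbit]. }
intros t.
apply (is_derive_ext (fun s => plus (RInt (orbit al y) 0 s) (x : realify A))).
{ intros s; etransitivity; [apply (f_equal (fun z => plus z x)); symmetry; apply E|].
  unfold orbit; generalize (al s x); intros; non_commutative_ring. }
rewrite -(plus_zero_r (al t y)).
apply (is_derive_plus (V := realify A)); [|apply (is_derive_const (V := realify A))].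
apply (is_derive_RInt (orbit al y) _ 0 t); [|apply continuous_orbit].
apply filter_forall; intros s; apply RInt_correct, orbit_integrable.
Qed.

(** Builds a smooth vector from its would-be derivatives; the limits of the sequences [D^j (u n)]
    form such a chain. *)
Lemma smooth_of_chain (l : nat -> A) :
  (forall j t, is_derive (orbit al (l j)) t (al t (l (S j)) : realify A)) ->
  forall j, is_smooth al (l j).
Proof.
intros H j n; revert j; induction n as [|n IH]; intros j; simpl.
- intros t; apply continuous_orbit.
- exists (orbit al (l (S j))); split; [apply H|apply IH].
Qed.

Lemma generator_iter_chain (l : nat -> A)
  (H : forall j t, is_derive (orbit al (l j)) t (al t (l (S j)) : realify A)) j :
  generator_iter al j (exist _ (l 0%nat) (smooth_of_chain l H 0)) =
  exist _ (l j) (smooth_of_chain l H j).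
Proof.
induction j as [|j IH]; [reflexivity|]; simpl; rewrite IH; apply generator_unique.
assert (H0 := H j 0); rewrite act_zero in H0; exact H0.
Qed.

Lemma generator_iter_minus j a b :
  generator_iter al j (minus a b) = minus (generator_iter al j a) (generator_iter al j b).
Proof.
unfold minus; rewrite generator_iter_plus; f_equal.
rewrite -!(scal_opp_one (V := Ainf_ModuleSpace al)); apply generator_iter_scal.
Qed.

(** Each sequence of [j]-th derivatives is Cauchy in [A]. Closedness of the generator makes its
    limits successive derivatives of one another, so the limit for [j = 0] is smooth with the right
    derivatives. *)
Theorem Ainf_complete (u : nat -> Ainf al) :
  (forall k e, 0 < e -> exists N, forall n m, (N <= n)%nat -> (N <= m)%nat ->
     Ainf_seminorm al k (minus (u n) (u m)) < e) ->
  exists l, forall k e, 0 < e -> exists N, forall n, (N <= n)%nat ->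
     Ainf_seminorm al k (minus (u n) l) < e.
Proof.
intros Hu; set (v := fun j n => sval al (generator_iter al j (u n))).
set (l := fun j => iota (fun x : A => filterlim (v j) eventually (locally x))).
assert (Hl : forall j, filterlim (v j) eventually (locally (l j))).
{ intros j; unfold l;
    apply (iota_correct (V := A) (fun x => filterlim (v j) eventually (locally x))).
  destruct (norm_cauchy_complete (V := A) (v j)) as [x Hx].
  - intros e He; destruct (Hu j e He) as [N HN]; exists N; intros n m Hn Hm.
    eapply Rle_lt_trans; [|apply (HN n m Hn Hm)].
    eapply Rle_trans; [|apply (seminorm_ge al j j); lia].
    rewrite generator_iter_minus; apply Rle_refl.
  - exists x; split; [exact Hx|]; intros y Hy; exact (cs_limit_unique _ _ _ Hx Hy). }
assert (Hd : forall j t, is_derive (orbit al (l j)) t (al t (l (S j)) : realify A)).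
{ intros j; apply (is_derive_orbit_limit (v j) (v (S j))); [|apply Hl|apply Hl].
  intros n t; apply is_derive_orbit. }
exists (exist _ (l 0%nat) (smooth_of_chain l Hd 0)); intros k e He.
(* One threshold serves the finitely many orders up to [k]; [e / 2] leaves room for the strict
   inequality, since [seminorm_le] is not strict. *)
assert (HN : exists N, forall n, (N <= n)%nat -> forall j, (j <= k)%nat ->
  norm (minus (v j n) (l j)) <= e / 2).
{ induction k as [|k [N IH]].
  - destruct (proj1 (cs_filterlim_iff _ _) (Hl 0%nat) (e / 2)) as [N HN]; [lra|].
    exists N; intros n Hn j Hj; replace j with 0%nat by lia; left; auto.
  - destruct (proj1 (cs_filterlim_iff _ _) (Hl (S k)) (e / 2)) as [N' HN]; [lra|].
    exists (N + N')%nat; intros n Hn j Hj; destruct (Nat.eq_dec j (S k)) as [->|Hne].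
    + left; apply HN; lia.
    + apply IH; lia. }
destruct HN as [N HN]; exists N; intros n Hn.
apply Rle_lt_trans with (e / 2); [|lra].
apply seminorm_le; intros j Hj.
rewrite generator_iter_minus generator_iter_chain; apply HN; assumption.
Qed.

End Completeness.

Section Products.
Context {A : CStarAlgebra} (al : CircleAction A).
Implicit Types (x y : A) (a b : Ainf al).

Lemma Ainf_ge0_decompose a : Ainf_ge0 al a ->
  sval al a = plus (fourier al 0 (sval al a)) (sval al (positive_part al a)).
Proof.
intros Ha; set (x := sval al a).
assert (E : minus x (plus (fourier al 0 x) (sval al (positive_part al a))) = zero).
{ apply (fourier_injective al); intros m.
  rewrite (real_linear_minus _ _ _ (real_linear_fourier al m)) fourier_plus.
  rewrite fourier_positive_part.
  destruct (Z.eq_dec m 0) as [->|Hm].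
  - rewrite (fourier_of_weight al 0 _ (has_weight_fourier al 0 x)).
    simpl; non_commutative_ring.
  - rewrite (fourier_of_other_weight al m 0 _ Hm (has_weight_fourier al 0 x)).
    destruct (Z.ltb_spec 0 m) as [H|H].
    + unfold x; non_commutative_ring.
    + assert (H0 := Ha m ltac:(lia)); rewrite fourier_projE in H0; unfold x; rewrite H0.
      non_commutative_ring. }
transitivity (plus (minus x (plus (fourier al 0 x) (sval al (positive_part al a))))
  (plus (fourier al 0 x) (sval al (positive_part al a)))).
- generalize (fourier al 0 x) (sval al (positive_part al a)); intros.
  unfold x; non_commutative_ring.
- rewrite E; apply plus_zero_l.
Qed.

(** Only [a] is expanded. A component of weight [k >= 1] meets the coefficient of [b] at
    [m - k < 0], which vanishes; the weight-zero component alone survives. *)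
Lemma fourier_mul_ge0 m a b : Ainf_ge0 al a -> Ainf_ge0 al b -> (m <= 0)%Z ->
  fourier al m (cs_mul (sval al a) (sval al b)) =
  cs_mul (fourier al 0 (sval al a)) (fourier al m (sval al b)).
Proof.
intros Ha Hb Hm; rewrite {1}(Ainf_ge0_decompose a Ha) cs_mul_plus_l fourier_plus.
rewrite (fourier_mul_weight al 0 m _ _ (has_weight_fourier al 0 _)) Z.sub_0_r.
assert (E : fourier al m (cs_mul (sval al (positive_part al a)) (sval al b)) = zero).
{ apply (real_linear_smoothing_zero al (fun z => fourier al m (cs_mul z (sval al b)))).
  - apply (real_linear_comp (fun z => cs_mul z (sval al b)));
      [apply real_linear_mul_r|apply real_linear_fourier].
  - intros k r x Hk; rewrite cs_mul_scal_l fourier_scal.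
    rewrite (fourier_mul_weight al k m _ _ (has_weight_fourier al k x)).
    assert (H0 := Hb (m - k)%Z ltac:(lia)); rewrite fourier_projE in H0.
    rewrite H0 cs_mul_zero_r; apply cs_scal_zero. }
rewrite E; apply plus_zero_r.
Qed.

Lemma star_equivariant : equivariant al cs_star.
Proof. split; [apply real_linear_star|intros; symmetry; apply act_star]. Qed.

Definition Ainf_star a : Ainf al := lift al _ star_equivariant a.

Lemma Ainf_star_ge0 a : Ainf_le0 al a -> Ainf_ge0 al (Ainf_star a).
Proof.
intros Ha m Hm; rewrite fourier_projE; etransitivity; [apply fourier_star|].
assert (H := Ha (- m)%Z ltac:(lia)); rewrite fourier_projE in H.
rewrite H; apply star_zero.
Qed.

(** The involution reverses weights and factors, so this is the adjoint of [fourier_mul_ge0], with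
    the weight-zero factor now on the right. *)
Lemma fourier_mul_le0 m a b : Ainf_le0 al a -> Ainf_le0 al b -> (0 <= m)%Z ->
  fourier al m (cs_mul (sval al a) (sval al b)) =
  cs_mul (fourier al m (sval al a)) (fourier al 0 (sval al b)).
Proof.
intros Ha Hb Hm.
rewrite -(cs_star_star A (cs_mul (sval al a) (sval al b))) cs_star_mul fourier_star.
assert (H := fourier_mul_ge0 (- m) (Ainf_star b) (Ainf_star a)
  (Ainf_star_ge0 b Hb) (Ainf_star_ge0 a Ha) ltac:(lia)).
change (fourier al (- m) (cs_mul (cs_star (sval al b)) (cs_star (sval al a))) =
  cs_mul (fourier al 0 (cs_star (sval al b))) (fourier al (- m) (cs_star (sval al a))))
  in H.
rewrite H cs_star_mul !fourier_star Z.opp_involutive !cs_star_star; reflexivity.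
Qed.

End Products.

Section State.
Context {A : CStarAlgebra} (om : A -> C) (Hom : is_state om).
Implicit Types x y : A.

Lemma state_minus x y : om (minus x y) = (om x - om y)%C.
Proof.
unfold minus; rewrite (state_plus _ Hom); unfold Cminus; f_equal.
rewrite -(scal_opp_one (V := A)).
etransitivity; [apply (state_scal _ Hom)|].
change (- (1) * om y = - om y)%C; ring.
Qed.

Lemma state_zero : om zero = RtoC 0.
Proof.
rewrite -(scal_zero_l (V := A) zero).
etransitivity; [apply (state_scal _ Hom)|]; apply Cmult_0_l.
Qed.

(** [state_norm] speaks of the unit ball. Rescaling by [norm x + e], which is positive, avoids
    singling out [x = 0]. *)
Lemma state_norm_le x : Cmod (om x) <= norm x.
Proof.
apply le_epsilon; intros e He; assert (H0 := cs_norm_ge_0 x).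
set (r := norm x + e); assert (Hr : 0 < r) by (unfold r; lra).
assert (H : Cmod (om (scal (RtoC (/ r)) x)) <= 1).
{ apply (proj1 (state_norm _ Hom)); eexists; split; [|reflexivity].
  rewrite cs_norm_scal Cmod_R Rabs_pos_eq; [|left; apply Rinv_0_lt_compat, Hr].
  apply (Rmult_le_reg_l r); [exact Hr|].
  rewrite -Rmult_assoc Rinv_r ?Rmult_1_l; [unfold r; lra|lra]. }
rewrite (state_scal _ Hom) Cmod_mult Cmod_R Rabs_pos_eq in H;
  [|left; apply Rinv_0_lt_compat, Hr].
apply (Rmult_le_compat_l r) in H; [|lra].
rewrite -Rmult_assoc Rinv_r ?Rmult_1_l in H; lra.
Qed.

Context (al : CircleAction A) (Hinv : invariant al om).

(** The functional is constant along orbits, so averaging an orbit does not change its value. It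
    serves for the real and the imaginary part of the state. *)
Lemma invariant_functional_fourier0 (f : A -> R) x :
  is_linear (K := R_AbsRing) (U := realify A) (V := R_NormedModule) f ->
  (forall t y, f (al t y) = f y) -> f (fourier al 0 x) = f x.
Proof.
intros Hf Hi; unfold fourier.
etransitivity; [exact (linear_scal (U := realify A) (V := R_NormedModule) f Hf _ _)|].
assert (H := RInt_linear (U := realify A) (V := R_CompleteNormedModule) f
  (fun t => scal (cis (- (IZR 0 * t))) (al t x)) 0 (2 * PI) Hf
  (continuous_fourier_integrand al 0 x)).
rewrite (RInt_ext _ (fun _ => f x)) in H.
- rewrite RInt_const in H.
  change ((2 * PI - 0) * f x = f (RInt (V := realify A)
    (fun t => scal (cis (- (IZR 0 * t))) (al t x)) 0 (2 * PI))) in H.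
  etransitivity; [apply f_equal; symmetry; exact H|].
  change (/ (2 * PI) * ((2 * PI - 0) * f x) = f x); field; apply PI_neq0.
- intros t _; rewrite Rmult_0_l Ropp_0 cis_0 cs_scal_1; apply Hi.
Qed.

Lemma state_fourier0 x : om (fourier al 0 x) = om x.
Proof.
apply injective_projections.
- apply (invariant_functional_fourier0 (fun x => fst (om x)));
    [|intros t y; rewrite Hinv; reflexivity].
  split.
  + intros a b; rewrite (state_plus _ Hom); reflexivity.
  + intros k a; etransitivity; [apply f_equal, (state_scal _ Hom (RtoC k))|].
    simpl; change (k * fst (om a) - 0 * snd (om a) = k * fst (om a)); ring.
  + exists 1; split; [lra|]; intros y; rewrite Rmult_1_l.
    eapply Rle_trans; [|apply state_norm_le].
    exact (Rle_trans _ _ _ (Rmax_l _ _) (Rmax_Cmod (om y))).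
- apply (invariant_functional_fourier0 (fun x => snd (om x)));
    [|intros t y; rewrite Hinv; reflexivity].
  split.
  + intros a b; rewrite (state_plus _ Hom); reflexivity.
  + intros k a; etransitivity; [apply f_equal, (state_scal _ Hom (RtoC k))|].
    simpl; change (k * snd (om a) + 0 * fst (om a) = k * snd (om a)); ring.
  + exists 1; split; [lra|]; intros y; rewrite Rmult_1_l.
    eapply Rle_trans; [|apply state_norm_le].
    exact (Rle_trans _ _ _ (Rmax_r _ _) (Rmax_Cmod (om y))).
Qed.

End State.

(** * The double and its Manin triple *)

Section Double.
Context {A : CStarAlgebra} (al : CircleAction A).
Local Notation G := (lie_double al).
Local Notation q := (lie_double_seminorm al).
Local Notation br := (lie_double_bracket al).
Implicit Types (x y z w : G).

Lemma double_ext x y : sval al (fst x) = sval al (fst y) ->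
  sval al (snd x) = sval al (snd y) -> x = y.
Proof. intros H1 H2; apply injective_projections; apply Ainf_ext; assumption. Qed.

Lemma double_seminorm k : seminorm (V := G) (q k).
Proof.
destruct (seminorm_Ainf al k) as [H0 [Hp Hs]]; unfold lie_double_seminorm.
split; [|split].
- intros x; eapply Rle_trans; [apply (H0 (fst x))|apply Rmax_l].
- intros x y; apply Rmax_lub; (eapply Rle_trans; [apply Hp|]);
    apply Rplus_le_compat; first [apply Rmax_l|apply Rmax_r].
- intros c x.
  change (Rmax (Ainf_seminorm al k (scal c (fst x))) (Ainf_seminorm al k (scal c (snd x)))
    = Cmod c * Rmax (Ainf_seminorm al k (fst x)) (Ainf_seminorm al k (snd x))).
  rewrite !Hs RmaxRmult; [reflexivity|apply Cmod_ge_0].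
Qed.

Lemma double_seminorm_mono j k x : (j <= k)%nat -> q j x <= q k x.
Proof.
intros H; apply Rmax_lub; (eapply Rle_trans; [apply seminorm_mono, H|]);
  first [apply Rmax_l|apply Rmax_r].
Qed.

Lemma double_seminorm_bracket k x y : q k (br x y) <= 2 ^ S k * (q k x * q k y).
Proof.
assert (Hp : 0 <= 2 ^ S k) by (apply pow_le; lra).
apply Rmax_lub; (eapply Rle_trans; [apply seminorm_bracket|]);
  apply Rmult_le_compat_l; try exact Hp; apply Rmult_le_compat;
  first [apply seminorm_ge_0|apply Rmax_l|apply Rmax_r].
Qed.

Lemma double_limit_nbhs (u : nat -> G) (l : G) :
  (forall k e, 0 < e -> exists N, forall n, (N <= n)%nat -> q k (minus (u n) l) < e) ->
  filterlim u eventually (sn_nbhs q l).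
Proof.
intros H P [k [d HP]]; destruct (H k d (cond_pos d)) as [N HN].
exists N; intros n Hn; apply HP; intros j Hj.
eapply Rle_lt_trans; [apply double_seminorm_mono, Hj|apply HN, Hn].
Qed.

Lemma double_complete (u : nat -> G) : sn_cauchy q u ->
  exists l, (forall k e, 0 < e -> exists N, forall n, (N <= n)%nat ->
    q k (minus (u n) l) < e).
Proof.
intros Hu.
destruct (Ainf_complete al (fun n => fst (u n))) as [l1 H1].
{ intros k e He; destruct (Hu k (mkposreal e He)) as [N HN]; exists N; intros n m Hn Hm.
  eapply Rle_lt_trans; [|apply (HN n m Hn Hm)]; apply Rmax_l. }
destruct (Ainf_complete al (fun n => snd (u n))) as [l2 H2].
{ intros k e He; destruct (Hu k (mkposreal e He)) as [N HN]; exists N; intros n m Hn Hm.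
  eapply Rle_lt_trans; [|apply (HN n m Hn Hm)]; apply Rmax_r. }
exists (l1, l2); intros k e He.
destruct (H1 k e He) as [N1 HN1], (H2 k e He) as [N2 HN2].
exists (N1 + N2)%nat; intros n Hn; apply Rmax_lub_lt; [apply HN1|apply HN2]; lia.
Qed.

(** Seminorm 0 already dominates the norm of [A], so Fréchet convergence implies norm convergence of
    both components. Closedness can thus be checked in [A], where the conditions defining [p1] and
    [p2] are continuous. *)
Lemma double_frechet (E : G -> Prop) : subspace (V := G) E ->
  (forall (u : nat -> G) l, (forall n, E (u n)) ->
    filterlim (fun n => sval al (fst (u n))) eventually (locally (sval al (fst l))) ->
    filterlim (fun n => sval al (snd (u n))) eventually (locally (sval al (snd l))) ->
    E l) ->
  frechet_space q E.
Proof.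
intros Hs Hc; split; [exact Hs|split].
- intros x _ Hx; specialize (Hx 0%nat).
  assert (H : forall a, Ainf_seminorm al 0 a <= 0 -> sval al a = zero).
  { intros a Ha; apply (norm_eq_zero (V := A)), Rle_antisym; [|apply cs_norm_ge_0].
    eapply Rle_trans; [apply (norm_le_seminorm al 0)|exact Ha]. }
  apply double_ext; apply H; rewrite -Hx; [apply Rmax_l|apply Rmax_r].
- intros u Hu Hq; destruct (double_complete u Hq) as [l Hl].
  exists l; split; [|apply double_limit_nbhs, Hl].
  apply (Hc u l Hu); apply cs_filterlim_iff; intros e He;
    destruct (Hl 0%nat e He) as [N HN]; exists N; intros n Hn;
    (eapply Rle_lt_trans; [|apply (HN n Hn)]).
  + eapply Rle_trans; [apply (norm_le_seminorm al 0 (minus (fst (u n)) (fst l)))|].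
    apply Rmax_l.
  + eapply Rle_trans; [apply (norm_le_seminorm al 0 (minus (snd (u n)) (snd l)))|].
    apply Rmax_r.
Qed.

Lemma bracket_bilinear : bilinear (V := G) (W := G) br.
Proof.
assert (Hl : forall a b c : A,
  minus (cs_mul (plus a b) c) (cs_mul c (plus a b)) =
  plus (minus (cs_mul a c) (cs_mul c a)) (minus (cs_mul b c) (cs_mul c b)))
  by (intros; non_commutative_ring).
assert (Hr : forall a b c : A,
  minus (cs_mul c (plus a b)) (cs_mul (plus a b) c) =
  plus (minus (cs_mul c a) (cs_mul a c)) (minus (cs_mul c b) (cs_mul b c)))
  by (intros; non_commutative_ring).
split; intros; apply double_ext.
- apply Hl.
- apply Hl.
- apply Hr.
- apply Hr.
- simpl; rewrite cs_mul_scal_l cs_mul_scal_r; symmetry; apply cs_scal_minus.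
- simpl; rewrite cs_mul_scal_l cs_mul_scal_r; symmetry; apply cs_scal_minus.
- simpl; rewrite cs_mul_scal_l cs_mul_scal_r; symmetry; apply cs_scal_minus.
- simpl; rewrite cs_mul_scal_l cs_mul_scal_r; symmetry; apply cs_scal_minus.
Qed.

Lemma bracket_minus_expand x y z w : minus (br z w : G) (br x y) =
  plus (br (minus z x) (minus w y)) (plus (br (minus z x) y : G) (br x (minus w y))).
Proof.
assert (H : forall a b c d : A, minus (minus (cs_mul c d) (cs_mul d c))
    (minus (cs_mul a b) (cs_mul b a)) =
  plus (minus (cs_mul (minus c a) (minus d b)) (cs_mul (minus d b) (minus c a)))
    (plus (minus (cs_mul (minus c a) b) (cs_mul b (minus c a)))
      (minus (cs_mul a (minus d b)) (cs_mul (minus d b) a))))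
  by (intros; non_commutative_ring).
apply double_ext; apply H.
Qed.

Lemma bracket_continuous x y :
  filterlim (fun u => br (fst u) (snd u))
    (filter_prod (sn_nbhs q x) (sn_nbhs q y)) (sn_nbhs q (br x y)).
Proof.
intros P [k [d HP]].
assert (S0 := fun z => proj1 (double_seminorm k) z).
assert (Hx := S0 x); assert (Hy := S0 y); assert (Hd := cond_pos d).
set (c := 2 ^ S k); assert (Hc : 0 < c) by (apply pow_lt; lra).
(* For [e <= 1] the three terms of the expansion sum to at most [e * c * (1 + q k x + q k y)]; the
   extra 1 makes this strictly less than [e * M <= d]. *)
set (M := c * (1 + q k x + q k y) + 1).
assert (HM : 1 <= M).
{ unfold M; assert (0 <= c * (1 + q k x + q k y)) by (apply Rmult_le_pos; lra); lra. }
set (e := Rmin 1 (d / M)).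
assert (He : 0 < e) by (apply Rmin_glb_lt; [lra|apply Rdiv_lt_0_compat; lra]).
assert (He1 : e <= 1) by apply Rmin_l.
assert (HeM : e * M <= d).
{ apply Rle_trans with (d / M * M); [apply Rmult_le_compat_r; [lra|apply Rmin_r]|].
  right; field; lra. }
apply Filter_prod with (Q := fun z => q k (minus z x) < e)
  (R := fun w => q k (minus w y) < e).
- exists k, (mkposreal e He); intros z Hz; apply Hz; lia.
- exists k, (mkposreal e He); intros z Hz; apply Hz; lia.
- intros z w Hz Hw; apply HP; intros j Hj.
  eapply Rle_lt_trans; [apply double_seminorm_mono, Hj|].
  change (q k (minus (br z w) (br x y)) < d).
  rewrite bracket_minus_expand.
  destruct (double_seminorm k) as [_ [Ht _]].
  eapply Rle_lt_trans; [apply Ht|].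
  eapply Rle_lt_trans; [apply Rplus_le_compat_l, Ht|].
  assert (Bz := S0 (minus z x)); assert (Bw := S0 (minus w y)).
  assert (H1 := double_seminorm_bracket k (minus z x) (minus w y)).
  assert (H2 := double_seminorm_bracket k (minus z x) y).
  assert (H3 := double_seminorm_bracket k x (minus w y)).
  fold c in H1, H2, H3.
  assert (q k (minus z x) * q k (minus w y) <= e * 1) by (apply Rmult_le_compat; lra).
  assert (q k (minus z x) * q k y <= e * q k y) by (apply Rmult_le_compat_r; lra).
  assert (q k x * q k (minus w y) <= q k x * e) by (apply Rmult_le_compat_l; lra).
  apply Rle_lt_trans with (c * (e * 1 + (e * q k y + q k x * e))).
  + rewrite !Rmult_plus_distr_l; apply Rplus_le_compat;
      [eapply Rle_trans; [exact H1|]|apply Rplus_le_compat;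
        [eapply Rle_trans; [exact H2|]|eapply Rle_trans; [exact H3|]]];
      apply Rmult_le_compat_l; lra.
  + apply Rlt_le_trans with (e * M); [unfold M; lra|exact HeM].
Qed.

Lemma subspace_full : subspace (V := G) (fun _ => True).
Proof. repeat split. Qed.

Lemma double_lie_algebra : frechet_lie_algebra q br.
Proof.
split.
- apply double_seminorm.
- apply double_frechet; [apply subspace_full|auto].
- apply bracket_bilinear.
- intros x; apply double_ext; simpl; non_commutative_ring.
- assert (H : forall a b c : A, plus
    (minus (cs_mul a (minus (cs_mul b c) (cs_mul c b)))
      (cs_mul (minus (cs_mul b c) (cs_mul c b)) a))
    (plus (minus (cs_mul b (minus (cs_mul c a) (cs_mul a c)))
        (cs_mul (minus (cs_mul c a) (cs_mul a c)) b))
      (minus (cs_mul c (minus (cs_mul a b) (cs_mul b a)))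
        (cs_mul (minus (cs_mul a b) (cs_mul b a)) c))) = zero)
    by (intros; non_commutative_ring).
  intros x y z; apply double_ext; apply H.
- apply bracket_continuous.
Qed.

Lemma p1_subalgebra : frechet_lie_subalgebra q br (p1 al).
Proof.
split.
- apply double_frechet.
  + split; [exists zero; reflexivity|split].
    * intros x y [a ->] [b ->]; exists (plus a b); reflexivity.
    * intros c x [a ->]; exists (scal c a); reflexivity.
  + intros u l Hu H1 H2; exists (fst l); apply double_ext; [reflexivity|].
    refine (cs_limit_unique _ _ _ H2 _); eapply filterlim_ext; [|exact H1].
    intros n; destruct (Hu n) as [a Ha]; rewrite Ha; reflexivity.
- intros x y [a ->] [b ->]; exists (Ainf_bracket al a b); reflexivity.
Qed.

Lemma p2_iff x : p2 al x <->
  (forall m, (m < 0)%Z -> fourier al m (sval al (fst x)) = zero) /\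
  (forall m, (0 < m)%Z -> fourier al m (sval al (snd x)) = zero) /\
  plus (fourier al 0 (sval al (fst x))) (fourier al 0 (sval al (snd x))) = zero.
Proof. unfold p2; rewrite !pi0E; reflexivity. Qed.

Lemma p2_frechet : frechet_space q (p2 al).
Proof.
apply double_frechet.
- split; [|split].
  + apply p2_iff.
    assert (Z := fun m => real_linear_zero _ (real_linear_fourier al m)).
    split; [intros; apply Z|split; [intros; apply Z|]].
    etransitivity; [apply f_equal2; apply Z|apply plus_zero_r].
  + intros x y; rewrite !p2_iff; intros [X1 [X2 X3]] [Y1 [Y2 Y3]].
    split; [|split].
    * intros m Hm; etransitivity; [apply (fourier_plus al m)|].
      rewrite (X1 m Hm) (Y1 m Hm); apply plus_zero_r.
    * intros m Hm; etransitivity; [apply (fourier_plus al m)|].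
      rewrite (X2 m Hm) (Y2 m Hm); apply plus_zero_r.
    * etransitivity; [apply f_equal2; apply (fourier_plus al 0)|].
      rewrite (plus_interchange (G := NormedModule.AbelianMonoid _ A)) X3 Y3.
      apply plus_zero_r.
  + intros c x; rewrite !p2_iff; intros [X1 [X2 X3]]; split; [|split].
    * intros m Hm; etransitivity; [apply (fourier_scal al m)|].
      rewrite (X1 m Hm); apply cs_scal_zero.
    * intros m Hm; etransitivity; [apply (fourier_scal al m)|].
      rewrite (X2 m Hm); apply cs_scal_zero.
    * etransitivity; [apply f_equal2; apply (fourier_scal al 0)|].
      rewrite -cs_scal_plus X3; apply cs_scal_zero.
- intros u l Hu H1 H2; apply p2_iff.
  assert (F1 := fun m => filterlim_real_linear _ _ _ (real_linear_fourier al m) H1).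
  assert (F2 := fun m => filterlim_real_linear _ _ _ (real_linear_fourier al m) H2).
  split; [|split].
  + intros m Hm; apply (cs_limit_eventually_const _ _ _ 0 (fun n _ =>
      proj1 (proj1 (p2_iff (u n)) (Hu n)) m Hm) (F1 m)).
  + intros m Hm; apply (cs_limit_eventually_const _ _ _ 0 (fun n _ =>
      proj1 (proj2 (proj1 (p2_iff (u n)) (Hu n))) m Hm) (F2 m)).
  + apply (cs_limit_eventually_const _ _ _ 0 (fun n _ =>
      proj2 (proj2 (proj1 (p2_iff (u n)) (Hu n))))
      (cs_filterlim_plus _ _ _ _ (F1 0%Z) (F2 0%Z))).
Qed.

Lemma p2_subalgebra (weight0_abelian : forall a b : Ainf al,
    weight_space al 0 a -> weight_space al 0 b -> Ainf_bracket al a b = zero) :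
  frechet_lie_subalgebra q br (p2 al).
Proof.
split; [apply p2_frechet|].
assert (Hab : forall a b : Ainf al,
  minus (cs_mul (fourier al 0 (sval al a)) (fourier al 0 (sval al b)))
    (cs_mul (fourier al 0 (sval al b)) (fourier al 0 (sval al a))) = zero).
{ intros a b; exact (f_equal (sval al) (weight0_abelian (weight0_part al a)
    (weight0_part al b) (has_weight_fourier al 0 _) (has_weight_fourier al 0 _))). }
(* The range includes [m = 0], where commutativity of the weight-zero parts enters. Both components
   of a bracket then have zero weight-zero part, and the matching condition of [p2] reads
   [0 + 0 = 0]. *)
assert (Hge : forall a b m, Ainf_ge0 al a -> Ainf_ge0 al b -> (m <= 0)%Z ->
  fourier al m (sval al (Ainf_bracket al a b)) = zero).
{ intros a b m Ha Hb Hm.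
  etransitivity; [apply (real_linear_minus _ _ _ (real_linear_fourier al m))|].
  rewrite !fourier_mul_ge0; try assumption.
  destruct (Z.eq_dec m 0) as [->|Hne]; [apply Hab|].
  assert (E1 := Ha m ltac:(lia)); assert (E2 := Hb m ltac:(lia)).
  rewrite fourier_projE in E1; rewrite fourier_projE in E2; rewrite E1 E2.
  rewrite !cs_mul_zero_r; non_commutative_ring. }
assert (Hle : forall a b m, Ainf_le0 al a -> Ainf_le0 al b -> (0 <= m)%Z ->
  fourier al m (sval al (Ainf_bracket al a b)) = zero).
{ intros a b m Ha Hb Hm.
  etransitivity; [apply (real_linear_minus _ _ _ (real_linear_fourier al m))|].
  rewrite !fourier_mul_le0; try assumption.
  destruct (Z.eq_dec m 0) as [->|Hne]; [apply Hab|].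
  assert (E1 := Ha m ltac:(lia)); assert (E2 := Hb m ltac:(lia)).
  rewrite fourier_projE in E1; rewrite fourier_projE in E2; rewrite E1 E2.
  rewrite !cs_mul_zero_l; non_commutative_ring. }
intros x y [X1 [X2 _]] [Y1 [Y2 _]]; apply p2_iff; split; [|split].
- intros m Hm; apply Hge; [exact X1|exact Y1|lia].
- intros m Hm; apply Hle; [exact X2|exact Y2|lia].
- etransitivity; [apply f_equal2; [apply Hge|apply Hle]|apply plus_zero_r];
    first [assumption|lia].
Qed.

Definition proj_p2 z : G :=
  let w := minus (fst z) (snd z) in (hardy al w, minus (hardy al w) w).

Definition proj_p1 z : G :=
  let w := minus (fst z) (snd z) in
  (minus (fst z) (hardy al w), minus (fst z) (hardy al w)).

Lemma proj_p2_in z : p2 al (proj_p2 z).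
Proof.
apply p2_iff; unfold proj_p2; cbv zeta; set (w := minus (fst z) (snd z)).
change (snd (hardy al w, minus (hardy al w) w)) with (minus (hardy al w) w).
change (fst (hardy al w, minus (hardy al w) w)) with (hardy al w).
assert (Hm : forall m, fourier al m (sval al (minus (hardy al w) w)) =
  minus (fourier al m (sval al (hardy al w))) (fourier al m (sval al w)))
  by (intros m; apply (real_linear_minus _ _ _ (real_linear_fourier al m))).
split; [|split].
- intros m Hm0; rewrite fourier_hardy.
  destruct (Z.ltb_spec 0 m), (Z.eqb_spec m 0); try lia; reflexivity.
- intros m Hm0; rewrite Hm fourier_hardy.
  destruct (Z.ltb_spec 0 m); [|lia]; generalize (fourier al m (sval al w)).
  intros; non_commutative_ring.
- rewrite Hm fourier_hardy; change (0 <? 0)%Z with false; change (0 =? 0)%Z with true.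
  cbv iota; generalize (fourier al 0 (sval al w)); intros a.
  assert (E : a = plus (scal (RtoC (/ 2)) a) (scal (RtoC (/ 2)) a)).
  { rewrite -cs_scal_distr_r -{1}(cs_scal_1 a); f_equal.
    apply injective_projections; simpl; field. }
  assert (F : forall h b : A, b = plus h h -> plus h (minus h b) = zero)
    by (intros h b ->; non_commutative_ring).
  apply F, E.
Qed.

Lemma double_sum z : z = plus (proj_p1 z) (proj_p2 z).
Proof.
assert (H1 : forall a h : A, a = plus (minus a h) h) by (intros; non_commutative_ring).
assert (H2 : forall a b h : A, b = plus (minus a h) (minus h (minus a b)))
  by (intros; non_commutative_ring).
apply double_ext; [apply H1|apply H2].
Qed.

(** For a diagonal pair, the first component kills the negative weights, the second the positive
    ones, and the matching condition becomes [2 P_0 a = 0]; injectivity of the Fourier transform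
    concludes. *)
Lemma p1_inter_p2 x : p1 al x -> p2 al x -> x = zero.
Proof.
intros [a ->] H; apply p2_iff in H; destruct H as [H1 [H2 H3]].
simpl fst in *; simpl snd in *.
assert (E : sval al a = zero).
{ apply (fourier_injective al); intros m.
  destruct (Z.lt_total m 0) as [Hm|[->|Hm]]; [apply H1, Hm| |apply H2, Hm].
  apply opp_eq_zero; set (z := fourier al 0 (sval al a)) in *.
  transitivity (minus (plus z z) z); [non_commutative_ring|].
  rewrite H3; transitivity (opp z); [non_commutative_ring|].
  rewrite -(scal_opp_one (V := A)); f_equal.
  apply injective_projections; simpl; try reflexivity; apply Ropp_0. }
apply double_ext; exact E.
Qed.

Lemma double_seminorm_diff k z :
  Ainf_seminorm al k (minus (fst z) (snd z)) <= 2 * q k z.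
Proof.
eapply Rle_trans; [apply seminorm_minus|]; unfold lie_double_seminorm.
generalize (Rmax_l (Ainf_seminorm al k (fst z)) (Ainf_seminorm al k (snd z)))
  (Rmax_r (Ainf_seminorm al k (fst z)) (Ainf_seminorm al k (snd z))); lra.
Qed.

(** The difference [w] has seminorm at most twice that of [z]; the Hardy part contributes 3 times 2
    and subtracting [w] another 2. The other projection needs only 7, but the common constant lets
    one continuity lemma serve both. *)
Lemma proj_p2_bound k z : q k (proj_p2 z) <= 8 * q (S (S k)) z.
Proof.
assert (H1 := double_seminorm_diff (S (S k)) z).
unfold proj_p2; cbv zeta; set (w := minus (fst z) (snd z)) in *.
assert (H2 := seminorm_hardy al k w).
assert (H3 := seminorm_mono al k (S (S k)) w ltac:(lia)).
assert (H4 := seminorm_ge_0 al (S (S k)) w).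
apply Rmax_lub.
- change (Ainf_seminorm al k (hardy al w) <= 8 * q (S (S k)) z); lra.
- eapply Rle_trans; [apply seminorm_minus|]; lra.
Qed.

Lemma proj_p1_bound k z : q k (proj_p1 z) <= 8 * q (S (S k)) z.
Proof.
assert (H1 := double_seminorm_diff (S (S k)) z).
unfold proj_p1; cbv zeta; set (w := minus (fst z) (snd z)) in *.
assert (H2 := seminorm_hardy al k w).
assert (H3 := seminorm_mono al k (S (S k)) (fst z) ltac:(lia)).
assert (H4 := seminorm_ge_0 al (S (S k)) (fst z)).
assert (H5 : Ainf_seminorm al (S (S k)) (fst z) <= q (S (S k)) z) by apply Rmax_l.
apply Rmax_lub; (eapply Rle_trans; [apply seminorm_minus|]); lra.
Qed.

Lemma minus_minus_swap {H : AbelianGroup} (a b c d : H) :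
  minus (minus a b) (minus c d) = minus (minus a c) (minus b d).
Proof.
unfold minus; rewrite !opp_plus !opp_opp; apply plus_interchange.
Qed.

Lemma proj_p2_minus y x : minus (proj_p2 y) (proj_p2 x) = proj_p2 (minus y x).
Proof.
assert (E : minus (fst (minus y x)) (snd (minus y x)) =
  minus (minus (fst y) (snd y)) (minus (fst x) (snd x)))
  by apply (minus_minus_swap (H := Ainf_AbelianGroup al)).
unfold proj_p2; cbv zeta.
rewrite E (hardy_minus al (minus (fst y) (snd y)) (minus (fst x) (snd x))).
apply injective_projections; [reflexivity|].
apply (minus_minus_swap (H := Ainf_AbelianGroup al)).
Qed.

Lemma proj_p1_minus y x : minus (proj_p1 y) (proj_p1 x) = proj_p1 (minus y x).
Proof.
assert (E : minus (fst (minus y x)) (snd (minus y x)) =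
  minus (minus (fst y) (snd y)) (minus (fst x) (snd x)))
  by apply (minus_minus_swap (H := Ainf_AbelianGroup al)).
unfold proj_p1; cbv zeta.
rewrite E (hardy_minus al (minus (fst y) (snd y)) (minus (fst x) (snd x))).
apply injective_projections; apply (minus_minus_swap (H := Ainf_AbelianGroup al)).
Qed.

Lemma bounded_additive_continuous (f : G -> G) x :
  (forall y x, minus (f y) (f x) = f (minus y x)) ->
  (forall k z, q k (f z) <= 8 * q (S (S k)) z) ->
  filterlim f (sn_nbhs q x) (sn_nbhs q (f x)).
Proof.
intros Hm Hb P [k [d HP]]; assert (Hd := cond_pos d).
(* Controlling the argument up to order [k + 2] pays for the two lost orders at every [j <= k]. *)
exists (S (S k)), (mkposreal (d / 8) ltac:(lra)); intros y Hy; apply HP; intros j Hj.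
rewrite Hm; eapply Rle_lt_trans; [apply Hb|].
specialize (Hy (S (S j)) ltac:(lia)); simpl in Hy; lra.
Qed.

Lemma double_direct_sum : topological_direct_sum q (p1 al) (p2 al) proj_p1 proj_p2.
Proof.
split.
- intros z; eexists; reflexivity.
- apply proj_p2_in.
- apply double_sum.
- apply p1_inter_p2.
- intros z; apply bounded_additive_continuous; [apply proj_p1_minus|apply proj_p1_bound].
- intros z; apply bounded_additive_continuous; [apply proj_p2_minus|apply proj_p2_bound].
Qed.

(** The bracket preserves the order and the projection loses two, so the bounds of both sets at
    order [k + 2] control the image at order [k]. *)
Lemma coadjoint_bounded :
  bounded_bilinear_on q (p1 al) (p2 al) (fun x y => proj_p2 (br x y)).
Proof.
intros B1 B2 _ _ H1 H2 k.
destruct (H1 (S (S k))) as [M1 HM1], (H2 (S (S k))) as [M2 HM2].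
exists (8 * (2 ^ S (S (S k)) * (M1 * M2))); intros z [x [y [Hx [Hy ->]]]].
eapply Rle_trans; [apply proj_p2_bound|]; apply Rmult_le_compat_l; [lra|].
eapply Rle_trans; [apply double_seminorm_bracket|].
apply Rmult_le_compat_l; [apply pow_le; lra|].
apply Rmult_le_compat; auto; apply (proj1 (double_seminorm (S (S k)))).
Qed.

(** * The invariant bilinear form *)

Section Form.
Context (om : A -> C) (Hom : is_state om) (Htr : tracial om).
Local Notation form := (lie_double_form al om).

Lemma form_bilinear : bilinear (V := G) (W := C_NormedModule) form.
Proof.
split.
- intros x y z; unfold lie_double_form; simpl.
  rewrite !cs_mul_plus_l !(state_plus _ Hom).
  change (plus ?a ?b) with (Cplus a b); ring.
- intros x y z; unfold lie_double_form; simpl.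
  rewrite !cs_mul_plus_r !(state_plus _ Hom).
  change (plus ?a ?b) with (Cplus a b); ring.
- intros k x y; unfold lie_double_form; simpl.
  rewrite !cs_mul_scal_l !(state_scal _ Hom).
  change (scal k ?b) with (Cmult k b); ring.
- intros k x y; unfold lie_double_form; simpl.
  rewrite !cs_mul_scal_r !(state_scal _ Hom).
  change (scal k ?b) with (Cmult k b); ring.
Qed.

Lemma form_symmetric x y : form x y = form y x.
Proof. unfold lie_double_form.
rewrite (Htr (sval al (fst x))) (Htr (sval al (snd x))); reflexivity. Qed.

(** After expansion the two sides differ by [om (b (a c))] against [om ((a c) b)], which the trace
    property identifies. *)
Lemma form_invariant x y z : form (br x y) z = form x (br y z).
Proof.
assert (H : forall a b c : A, om (cs_mul (minus (cs_mul a b) (cs_mul b a)) c) =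
  om (cs_mul a (minus (cs_mul b c) (cs_mul c b)))).
{ intros a b c.
  transitivity (om (minus (cs_mul a (cs_mul b c)) (cs_mul b (cs_mul a c))));
    [f_equal; non_commutative_ring|].
  transitivity (om (minus (cs_mul a (cs_mul b c)) (cs_mul (cs_mul a c) b)));
    [|f_equal; non_commutative_ring].
  rewrite !(state_minus _ Hom) (Htr b); reflexivity. }
unfold lie_double_form; simpl; rewrite !H; reflexivity.
Qed.

Lemma form_nondegenerate (Hf : faithful om) x :
  (forall y, form x y = RtoC 0) -> x = zero.
Proof.
intros H; apply double_ext; apply Hf; rewrite Htr.
- rewrite -(H (Ainf_star al (fst x), zero)); unfold lie_double_form; simpl.
  rewrite cs_mul_zero_r (state_zero _ Hom); ring.
- assert (E := H (zero, Ainf_star al (snd x))); unfold lie_double_form in E; simpl in E.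
  rewrite cs_mul_zero_r (state_zero _ Hom) in E.
  assert (Hr : forall r : C, (RtoC 0 - r = RtoC 0 -> r = RtoC 0)%C).
  { intros r Hr; transitivity (- (RtoC 0 - r))%C; [ring|rewrite Hr; ring]. }
  exact (Hr _ E).
Qed.

Lemma form_isotropic_p1 x y : p1 al x -> p1 al y -> form x y = RtoC 0.
Proof. intros [a ->] [b ->]; unfold lie_double_form; simpl; ring. Qed.

(** Each term depends only on the weight-zero parts. Those of the second components are the
    negatives of the first ones, so both products agree and their difference vanishes. *)
Lemma form_isotropic_p2 (Hinv : invariant al om) x y :
  p2 al x -> p2 al y -> form x y = RtoC 0.
Proof.
intros Hx Hy; destruct (Hx) as [X1 [X2 _]], (Hy) as [Y1 [Y2 _]].
apply p2_iff in Hx; apply p2_iff in Hy.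
destruct Hx as [_ [_ X3]], Hy as [_ [_ Y3]].
unfold lie_double_form.
rewrite -(state_fourier0 _ Hom al Hinv (cs_mul (sval al (fst x)) _)).
rewrite -(state_fourier0 _ Hom al Hinv (cs_mul (sval al (snd x)) _)).
rewrite fourier_mul_ge0 ?fourier_mul_le0; try first [assumption|lia].
assert (E : forall a b : A, plus a b = zero -> b = opp a).
{ intros a b Hab; transitivity (minus (plus a b) a); [non_commutative_ring|].
  rewrite Hab; non_commutative_ring. }
rewrite (E _ _ X3) (E _ _ Y3).
replace (cs_mul (opp (fourier al 0 (sval al (fst x))))
  (opp (fourier al 0 (sval al (fst y))))) with
  (cs_mul (fourier al 0 (sval al (fst x))) (fourier al 0 (sval al (fst y))))
  by non_commutative_ring.
ring.
Qed.

Lemma form_bounded y : bounded_functional_on (V := G) q (p1 al) (form y).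
Proof.
intros B _ HB; destruct (HB 0%nat) as [M HM].
exists ((norm (sval al (fst y)) + norm (sval al (snd y))) * M); intros x Hx.
assert (H : forall a b : A, norm b <= M -> Cmod (om (cs_mul a b)) <= norm a * M).
{ intros a b Hb; eapply Rle_trans; [apply (state_norm_le _ Hom)|].
  eapply Rle_trans; [apply cs_norm_mul|].
  apply Rmult_le_compat_l; [apply cs_norm_ge_0|exact Hb]. }
unfold lie_double_form, Cminus.
eapply Rle_trans; [apply Cmod_triangle|]; rewrite Cmod_opp Rmult_plus_distr_r.
apply Rplus_le_compat; apply H; (eapply Rle_trans; [apply (norm_le_seminorm al 0)|]);
  (eapply Rle_trans; [|apply (HM x Hx)]); first [apply Rmax_l|apply Rmax_r].
Qed.

(** Isotropy of [p1] makes the [p1]-component of the bracket invisible to [z]; then antisymmetry and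
    invariance give [<[x, y], z> = - <[y, x], z> = - <y, [x, z]>]. *)
Lemma form_coadjoint x y z : p1 al x -> p2 al y -> p1 al z ->
  form (proj_p2 (br x y)) z = coadjoint br form x y z.
Proof.
intros Hx Hy Hz; unfold coadjoint.
assert (E : form (br x y) z = form (proj_p2 (br x y)) z).
{ rewrite {1}(double_sum (br x y)) (bil_plus_l _ form_bilinear).
  rewrite form_isotropic_p1; [exact (plus_zero_l (G := C_NormedModule) _)
    |eexists; reflexivity|exact Hz]. }
rewrite -E -form_invariant; unfold lie_double_form; simpl.
assert (H : forall a b c : A, om (cs_mul (minus (cs_mul a b) (cs_mul b a)) c) =
  (- om (cs_mul (minus (cs_mul b a) (cs_mul a b)) c))%C).
{ intros a b c.
  transitivity (om (cs_mul (cs_mul a b) c) - om (cs_mul (cs_mul b a) c))%C.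
  - rewrite -(state_minus _ Hom); f_equal; non_commutative_ring.
  - transitivity (- (om (cs_mul (cs_mul b a) c) - om (cs_mul (cs_mul a b) c)))%C; [ring|].
    rewrite -(state_minus _ Hom); do 2 f_equal; non_commutative_ring. }
assert (Hc : forall p r : C, (- p - - r = - (p - r))%C) by (intros; ring).
rewrite (H (sval al (fst x))) (H (sval al (snd x))); exact (Hc _ _).
Qed.

End Form.

End Double.

Theorem theorem5p12 (A : CStarAlgebra) (al : CircleAction A) (om : A -> C)
  (om_state : is_state om) (om_faithful : faithful om) (om_tracial : tracial om)
  (om_invariant : invariant al om)
  (weight0_abelian : forall a b : Ainf al,
    weight_space al 0 a -> weight_space al 0 b -> Ainf_bracket al a b = zero) :
  manin_triple (V := lie_double al) (lie_double_seminorm al) (lie_double_bracket al)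
    (lie_double_form al om) (p1 al) (p2 al).
Proof.
exists (proj_p1 al), (proj_p2 al); split.
- apply double_lie_algebra.
- apply p1_subalgebra.
- apply p2_subalgebra, weight0_abelian.
- apply double_direct_sum.
- apply form_bilinear, om_state.
- apply form_symmetric, om_tracial.
- apply form_invariant; assumption.
- apply form_nondegenerate; assumption.
- apply form_isotropic_p1.
- apply form_isotropic_p2; assumption.
- intros y _; apply form_bounded, om_state.
- apply form_coadjoint; assumption.
- apply coadjoint_bounded.
Qed.
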